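(* Let $f,g_t:(\mathbb{C}^3,0)\to(\mathbb{C},0)$ be given by $f(x,y,z)=x^{15}+y^{10}+z^6$ and $g_t(x,y,z)=xy+tz$, with $t\in\mathbb{C}$ a parameter near $0$, and let $$F_t=f^2-g_t^{12}=(f+g_t^6)(f-g_t^6):(\mathbb{C}^3,0)\to(\mathbb{C},0).$$ Then the family $F_t$ is topologically right-equivalent trivial.
   Context: A family of function germs $F_t:(\mathbb{C}^n,0)\to(\mathbb{C},0)$ is topologically right-equivalent trivial if, for $t$ near $0$, there is a continuous family of homeomorphisms $h_t$, each defined on a neighbourhood (independent of $t$) of $0\in\mathbb{C}^n$ onto a neighbourhood of $0$, with $h_t(0)=0$ and $F_t\circ h_t=F_0$. *)

(* Defs.v *)
From mathcomp Require Import all_boot all_order all_algebra.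
From mathcomp Require Import all_classical all_reals all_analysis.
From mathcomp Require Import complex.

Set Implicit Arguments.
Unset Strict Implicit.
Unset Printing Implicit Defensive.

Import Order.TTheory GRing.Theory Num.Theory.
Import numFieldNormedType.Exports.

Local Open Scope classical_set_scope.
Local Open Scope ring_scope.
Local Open Scope complex_scope.

(* [R[i]] itself carries no topology in the libraries; viewed as a
   [numClosedFieldType] it inherits the one induced by the modulus, and
   ['rV[Cplx R]_n] inherits the corresponding sup-norm topology. *)
Definition Cplx (R : realType) : numClosedFieldType := R[i].

Definition homeomorphism_onto (X Y : topologicalType) (A : set X) (B : set Y)
    (f : X -> Y) : Prop :=
  set_bij A B f /\ {within A, continuous f} /\
  exists g : Y -> X, {in A, cancel f g} /\ {within B, continuous g}.

(* The germs F_t are given by representatives defined on the whole space.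
   The neighbourhood U does not depend on t, whereas its image V may.
   "Continuous family" means that (t, x) |-> h_t(x) is jointly continuous. *)
Definition topologically_right_equivalent_trivial (R : realType) (n : nat)
    (F : Cplx R -> 'rV[Cplx R]_n -> Cplx R) : Prop :=
  exists (T : set (Cplx R)) (U : set 'rV[Cplx R]_n)
         (h : Cplx R -> 'rV[Cplx R]_n -> 'rV[Cplx R]_n),
    [/\ nbhs (0 : Cplx R) T,
        nbhs (0 : 'rV[Cplx R]_n) U,
        {within T `*` U,
          continuous (fun p : Cplx R * 'rV[Cplx R]_n => h p.1 p.2)} &
        forall t : Cplx R, T t ->
          [/\ exists2 V : set 'rV[Cplx R]_n,
                nbhs (0 : 'rV[Cplx R]_n) V & homeomorphism_onto U V (h t),
              h t 0 = 0 &
              forall x : 'rV[Cplx R]_n, U x -> F t (h t x) = F 0 x]].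

(* A point (x, y, z) is the row vector p with p 0 0 = x, p 0 1 = y, p 0 2 = z. *)
Definition f_fun (R : realType) (p : 'rV[Cplx R]_3) : Cplx R :=
  p 0 0 ^+ 15 + p 0 1 ^+ 10 + p 0 2 ^+ 6.

Definition g_fun (R : realType) (t : Cplx R) (p : 'rV[Cplx R]_3) : Cplx R :=
  p 0 0 * p 0 1 + t * p 0 2.

Definition F_fun (R : realType) (t : Cplx R) (p : 'rV[Cplx R]_3) : Cplx R :=
  f_fun p ^+ 2 - g_fun t p ^+ 12.

(* Main.v *)
Require Import Defs.
From mathcomp Require Import all_boot all_order all_algebra.
From mathcomp Require Import all_classical all_reals all_analysis.
From mathcomp Require Import complex.
From mathcomp Require Import ring lra.

Set Implicit Arguments.
Unset Strict Implicit.
Unset Printing Implicit Defensive.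

Import Order.TTheory GRing.Theory Num.Theory.
Import numFieldNormedType.Exports.

Local Open Scope classical_set_scope.
Local Open Scope ring_scope.
Local Open Scope complex_scope.

(** Give x, y, z the weights 2, 3, 5. Then f is weighted homogeneous of degree
30 and, for every t, g_t = xy + tz is weighted homogeneous of degree 5, so all
the F_t are weighted homogeneous of the same degree 60. It is therefore enough
to trivialize the family on the weighted sphere S where
|x|^30 + |y|^20 + |z|^12 = 1: a map k_t close to the identity on S with
F_t o k_t = F_0 extends to h_t(p) = rho(p).k_t(rho(p)^-1.p), where rho is the
weighted norm and the dot is the weighted action of scalars (F_cone_ext). The
h_t obtained in this way are defined on all of C^3.

The singular set of F_0 contains the curve f = g_0 = 0. Along it F_0 is
u^2 - w^12 in the coordinates u = f, w = g_0, because F_0 and the 2x2 minors of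
the Jacobian matrix of (f, g_0) have no common zero on S (F_gram_eq0). By
compactness (f, g_0) is a submersion, uniformly, on the part of S where |F_0| is
small (F_gram_bound). There the implicit function theorem moves p to p + t v
with f(p + t v) = f(p) and g_t(p + t v) = g_0(p); hence F_t(p + t v) = F_0(p). The formula for v makes sense on all of S once the
denominator, the Gram determinant of the two differentials, is truncated from
below, but then F_t(p + t v) differs from F_0(p) by a term t E, where E
vanishes as soon as |F_0| is small. Since F_0 is bounded away from zero on the
support of E, this defect is repaired by the weighted action of a scalar 1 + t c
with (1 + t c)^60 = F_0(p) / F_t(p + t v) (local_trivialization).

The functions v and c, and finally the inverse of h_t, solve equations of the
form v = A(x) + t B(x, v) with bounded Lipschitz data. For small t such an
equation has a unique solution in a ball, and the solution is again bounded and
Lipschitz in x (parametric_fixpoint). Applied to x = y - t W(t, x), where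
h_t = id + t W, it shows that h_t is bijective with an inverse of the same shape
(cone_ext_bijective). Joint continuity of such maps is
cone_ext_continuous_at. *)

(** * Complex modulus and rows of complex numbers *)

Section modulus.
Variable R : realType.
Local Notation C := (Cplx R).
Implicit Types z w : C.

(** The norm of the numeric field [Cplx R] takes its values in [Cplx R] itself;
estimates are carried out with this real-valued modulus, which supports linear
arithmetic over the ordered field R. *)
Definition cmod z : R := Normc.normc z.

Definition cj z : C := conjc z.

Definition rc (a : R) : C := a%:C.

Lemma cmodE z : `|z| = rc (cmod z).
Proof. by []. Qed.

Lemma cmod_ge0 z : 0 <= cmod z.
Proof. by case: z => a b; rewrite /cmod /= sqrtr_ge0. Qed.

Lemma cmod0 : cmod 0 = 0. Proof. exact: Normc.normc0. Qed.
Lemma cmod1 : cmod 1 = 1. Proof. exact: Normc.normc1. Qed.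
Lemma cmod_eq0 z : cmod z = 0 -> z = 0. Proof. exact: Normc.eq0_normc. Qed.
Lemma cmodM z w : cmod (z * w) = cmod z * cmod w. Proof. exact: Normc.normcM. Qed.
Lemma cmodD z w : cmod (z + w) <= cmod z + cmod w. Proof. exact: le_normcD. Qed.
Lemma cmodN z : cmod (- z) = cmod z. Proof. exact: normcN. Qed.
Lemma cmodB z w : cmod (z - w) = cmod (w - z). Proof. by rewrite -cmodN opprB. Qed.
Lemma cmodX z n : cmod (z ^+ n) = cmod z ^+ n.
Proof. by elim: n => [|n IH]; rewrite ?cmod1 // !exprS cmodM IH. Qed.

Lemma rcD (a b : R) : rc (a + b) = rc a + rc b.
Proof. exact: (rmorphD (real_complex R)). Qed.
Lemma rcB (a b : R) : rc (a - b) = rc a - rc b.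
Proof. exact: (rmorphB (real_complex R)). Qed.
Lemma rcM (a b : R) : rc (a * b) = rc a * rc b.
Proof. exact: (rmorphM (real_complex R)). Qed.
Lemma rcX (a : R) n : rc (a ^+ n) = rc a ^+ n.
Proof. exact: (rmorphXn (real_complex R)). Qed.
Lemma rcV (a : R) : rc (a^-1) = (rc a)^-1.
Proof. exact: (fmorphV (real_complex R)). Qed.
Lemma rc1 : rc 1 = 1. Proof. by []. Qed.
Lemma rc0 : rc 0 = 0. Proof. by []. Qed.
Lemma rc_inj : injective rc. Proof. by move=> a b []. Qed.

Lemma cmod_rc (a : R) : cmod (rc a) = `|a|.
Proof. by rewrite /cmod /rc /= expr0n addr0 sqrtr_sqr. Qed.

Lemma cjB z w : cj (z - w) = cj z - cj w. Proof. exact: (rmorphB (@conjc R)). Qed.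
Lemma cmod_cj z : cmod (cj z) = cmod z.
Proof. by case: z => a b; rewrite /cmod /= sqrrN. Qed.
Lemma mulcj z : z * cj z = rc (cmod z ^+ 2).
Proof. rewrite rcX -cmodE; symmetry; exact: sqr_normc. Qed.

Lemma cmod_le_D z w : cmod z <= cmod w + cmod (z - w).
Proof. by apply: le_trans (cmodD _ _); rewrite addrC subrK. Qed.

Lemma cmod_ge_Re z : `|complex.Re z| <= cmod z.
Proof. by have := normc_ge_Re z; rewrite [X in _ <= X]cmodE lecR. Qed.

Lemma cmod_ge_Im z : `|complex.Im z| <= cmod z.
Proof.
case: z => a b; rewrite /cmod /= -sqrtr_sqr ler_wsqrtr// lerDr; exact: sqr_ge0.
Qed.

Lemma cmod_le_ReIm z : cmod z <= `|complex.Re z| + `|complex.Im z|.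
Proof.
rewrite {1}(complexE z); apply: le_trans (cmodD _ _) _.
rewrite cmodM (cmod_rc (complex.Re z)) (cmod_rc (complex.Im z)) lerD2l.
by rewrite /cmod /= expr0n add0r expr1n sqrtr1 mul1r.
Qed.

Lemma cmod_lip z w : `|cmod z - cmod w| <= cmod (z - w).
Proof.
have := cmod_le_D z w; have := cmod_le_D w z; rewrite (cmodB w z) => h1 h2.
by rewrite ler_norml; apply/andP; split; lra.
Qed.

Definition norm1 n (v : 'rV[C]_n) : R := \sum_i cmod (v 0 i).

Lemma norm1_ge0 n (v : 'rV[C]_n) : 0 <= norm1 v.
Proof. by apply: sumr_ge0 => i _; exact: cmod_ge0. Qed.

Lemma cmod_le_norm1 n (v : 'rV[C]_n) i : cmod (v 0 i) <= norm1 v.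
Proof.
rewrite /norm1 (bigD1 i) //= lerDl; apply: sumr_ge0 => j _; exact: cmod_ge0.
Qed.

Lemma norm1D n (v w : 'rV[C]_n) : norm1 (v + w) <= norm1 v + norm1 w.
Proof.
by rewrite /norm1 -big_split /=; apply: ler_sum => i _; rewrite mxE cmodD.
Qed.

Lemma norm1N n (v : 'rV[C]_n) : norm1 (- v) = norm1 v.
Proof. by apply: eq_bigr => i _; rewrite mxE cmodN. Qed.

Lemma norm1B n (v w : 'rV[C]_n) : norm1 (v - w) = norm1 (w - v).
Proof. by rewrite -norm1N opprB. Qed.

Lemma norm1Z n a (v : 'rV[C]_n) : norm1 (a *: v) = cmod a * norm1 v.
Proof. by rewrite /norm1 mulr_sumr; apply: eq_bigr => i _; rewrite mxE cmodM. Qed.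

Lemma norm10 n : norm1 (0 : 'rV[C]_n) = 0.
Proof. by rewrite /norm1 big1 // => i _; rewrite mxE cmod0. Qed.

Lemma norm1_eq0 n (v : 'rV[C]_n) : norm1 v = 0 -> v = 0.
Proof.
move=> v0; apply/rowP => i; rewrite mxE; apply: cmod_eq0.
by apply: le_anti; rewrite cmod_ge0 andbT -v0 cmod_le_norm1.
Qed.

(** The intervals of radius 2K/2^n around u_n are nested, so the supremum of
their left ends lies in all of them. *)
Lemma real_geometric_limit (u : nat -> R) (K : R) :
  (forall n, `|u n - u n.+1| <= K / 2 ^+ n) ->
  exists l, forall n, `|u n - l| <= 2 * K / 2 ^+ n.
Proof.
move=> hu.
have K0 : 0 <= K by have := hu 0; rewrite expr0 divr1; apply: le_trans.
(* e n is the tail of the geometric series of step sizes *)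
pose e n : R := 2 * K / 2 ^+ n.
have eS n : e n.+1 = e n - K / 2 ^+ n by rewrite /e exprS; field; rewrite expf_neq0.
have e0 n : 0 <= e n by rewrite /e divr_ge0 ?exprn_ge0 ?mulr_ge0.
have inc m n : u m - e m <= u (m + n)%N - e (m + n)%N.
  elim: n => [|n IH]; first by rewrite addn0.
  rewrite addnS eS; have := hu (m + n)%N; rewrite ler_norml => /andP[_]; lra.
have dec m n : u (m + n)%N + e (m + n)%N <= u m + e m.
  elim: n => [|n IH]; first by rewrite addn0.
  rewrite addnS eS; have := hu (m + n)%N; rewrite ler_norml => /andP[+ _]; lra.
have cross m n : u m - e m <= u n + e n.
  have := inc m n; have := dec n m; rewrite (addnC n m).
  have := e0 (m + n)%N; lra.
pose S := [set x | exists n, x = u n - e n].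
have S0 : S !=set0 by exists (u 0%N - e 0%N); exists 0%N.
have Sub n : ubound S (u n + e n) by move=> x [m ->].
exists (sup S) => n.
have h1 : u n - e n <= sup S.
  by apply: ub_le_sup; [exists (u 0%N + e 0%N) | exists n].
have h2 : sup S <= u n + e n by apply: ge_sup => //; exact: Sub.
by rewrite ler_norml; apply/andP; split; rewrite -/(e n); lra.
Qed.

Lemma row_geometric_limit n (u : nat -> 'rV[C]_n) (K : R) :
  (forall k, norm1 (u k - u k.+1) <= K / 2 ^+ k) ->
  exists (l : 'rV[C]_n) (K' : R), forall k, norm1 (u k - l) <= K' / 2 ^+ k.
Proof.
move=> hu.
have hmd k i : cmod (u k 0 i - u k.+1 0 i) <= K / 2 ^+ k.
  by apply: le_trans (hu k); have := cmod_le_norm1 (u k - u k.+1) i; rewrite !mxE.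
have ex i : exists l : C, forall k, cmod (u k 0 i - l) <= 4 * K / 2 ^+ k.
  have [|a ha] := @real_geometric_limit (fun k => complex.Re (u k 0 i)) K.
    move=> k; apply: le_trans (hmd k i); apply: le_trans (cmod_ge_Re _).
    by case: (u k 0 i) (u k.+1 0 i) => [a b] [c d].
  have [|b hb] := @real_geometric_limit (fun k => complex.Im (u k 0 i)) K.
    move=> k; apply: le_trans (hmd k i); apply: le_trans (cmod_ge_Im _).
    by case: (u k 0 i) (u k.+1 0 i) => [? ?] [? ?].
  exists (a +i* b) => k; apply: le_trans (cmod_le_ReIm _) _.
  move: (ha k) (hb k); case: (u k 0 i) => c d /= h1 h2; lra.
have [l hl] := choice ex.
exists (\row_i l i), (\sum_(i < n) (4 * K)) => k.
rewrite mulr_suml; apply: ler_sum => i _; rewrite !mxE; exact: hl.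
Qed.

End modulus.

(** * Bounded Lipschitz functions and a fixed point theorem with parameters *)

Section bounded_lipschitz.
Variable R : realType.
Local Notation C := (Cplx R).

(** Only Lipschitz constants are read off from the distance, hence the short list
of axioms. *)
Record gauged := Gauged {
  gcar :> Type;
  gdist : gcar -> gcar -> R;
  gdist_ge0 : forall x y, 0 <= gdist x y;
  gdistxx : forall x, gdist x x = 0 }.

Lemma cmodxx (z : C) : cmod (z - z) = 0. Proof. by rewrite subrr cmod0. Qed.

Definition gauged_C : gauged :=
  @Gauged C (fun z w => cmod (z - w)) (fun z w => cmod_ge0 _) cmodxx.

Lemma norm1xx n (v : 'rV[C]_n) : norm1 (v - v) = 0.
Proof. by rewrite subrr norm10. Qed.

Definition gauged_row n : gauged :=
  @Gauged 'rV[C]_n (fun v w => norm1 (v - w)) (fun v w => norm1_ge0 _) (@norm1xx n).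

Lemma gauged_prodxx (X Y : gauged) (p : X * Y) : gdist p.1 p.1 + gdist p.2 p.2 = 0.
Proof. by rewrite !gdistxx addr0. Qed.

Definition gauged_prod (X Y : gauged) : gauged :=
  @Gauged (X * Y) (fun p q => gdist p.1 q.1 + gdist p.2 q.2)
    (fun p q => addr_ge0 (gdist_ge0 _ _) (gdist_ge0 _ _)) (@gauged_prodxx X Y).

(** Bounded and Lipschitz with one common constant. Boundedness is part of the
notion because it makes the class stable under products. *)
Definition blip (X : gauged) (D : X -> Prop) (f : X -> C) :=
  exists M, [/\ 0 <= M, forall x, D x -> cmod (f x) <= M &
    forall x y, D x -> D y -> cmod (f x - f y) <= M * gdist x y].

Definition lipm (X Y : gauged) (D : X -> Prop) (f : X -> Y) :=
  exists2 M, 0 <= M & forall x y, D x -> D y -> gdist (f x) (f y) <= M * gdist x y.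

Section closure.
Variables (X : gauged) (D : X -> Prop).
Implicit Types f g : X -> C.

Lemma blipI f M L : (forall x, D x -> cmod (f x) <= M) ->
  (forall x y, D x -> D y -> cmod (f x - f y) <= L * gdist x y) -> blip D f.
Proof.
move=> hM hL; exists (`|M| + `|L|); split; first exact: addr_ge0.
- by move=> x /hM h; apply: le_trans h _; rewrite (le_trans (ler_norm _))// lerDl.
move=> x y Dx Dy; apply: le_trans (hL _ _ Dx Dy) _.
by rewrite ler_wpM2r ?gdist_ge0// (le_trans (ler_norm _))// lerDr.
Qed.

Lemma eq_blip f g : (forall x, D x -> f x = g x) -> blip D f -> blip D g.
Proof.
move=> e [M [M0 h1 h2]]; exists M; split => // [x Dx|x y Dx Dy].
  by rewrite -e ?h1.
by rewrite -!e ?h2.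
Qed.

Lemma blip_cst (c : C) : blip D (fun=> c).
Proof.
by apply: (@blipI _ (cmod c) 0) => // x y _ _; rewrite subrr cmod0 mul0r.
Qed.

Lemma blipD f g : blip D f -> blip D g -> blip D (fun x => f x + g x).
Proof.
move=> [M [M0 f1 f2]] [N [N0 g1 g2]]; apply: (@blipI _ (M + N) (M + N)).
  by move=> x Dx; rewrite (le_trans (cmodD _ _))// lerD ?f1 ?g1.
move=> x y Dx Dy; rewrite opprD addrACA mulrDl.
by rewrite (le_trans (cmodD _ _))// lerD ?f2 ?g2.
Qed.

Lemma blipN f : blip D f -> blip D (fun x => - f x).
Proof.
move=> [M [M0 f1 f2]]; exists M; split => // [x Dx|x y Dx Dy].
  by rewrite cmodN f1.
by rewrite -opprD cmodN f2.
Qed.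

Lemma blipM f g : blip D f -> blip D g -> blip D (fun x => f x * g x).
Proof.
move=> [M [M0 f1 f2]] [N [N0 g1 g2]]; apply: (@blipI _ (M * N) (M * N + M * N)).
  by move=> x Dx; rewrite cmodM ler_pM ?cmod_ge0 ?f1 ?g1.
move=> x y Dx Dy.
have -> : f x * g x - f y * g y = f x * (g x - g y) + (f x - f y) * g y by ring.
rewrite (le_trans (cmodD _ _))// !cmodM mulrDl lerD//.
  by rewrite -mulrA ler_pM ?cmod_ge0 ?f1 ?g2.
by rewrite mulrAC ler_pM ?cmod_ge0 ?f2 ?g1.
Qed.

Lemma blipX f n : blip D f -> blip D (fun x => f x ^+ n).
Proof.
move=> hf; elim: n => [|n IH]; first exact: blip_cst.
by apply: (@eq_blip (fun x => f x * f x ^+ n)) => [x _|]; rewrite ?exprS//; exact: blipM.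
Qed.

Lemma blip_cj f : blip D f -> blip D (fun x => cj (f x)).
Proof.
move=> [M [M0 f1 f2]]; exists M; split => // [x Dx|x y Dx Dy].
  by rewrite cmod_cj f1.
by rewrite -cjB cmod_cj f2.
Qed.

Lemma blip_cmod f : blip D f -> blip D (fun x => rc (cmod (f x))).
Proof.
move=> [M [M0 f1 f2]]; exists M; split => // [x Dx|x y Dx Dy].
  by rewrite cmod_rc ger0_norm ?cmod_ge0 ?f1.
rewrite -rcB cmod_rc; exact: le_trans (cmod_lip _ _) (f2 _ _ Dx Dy).
Qed.

(** Real-valued functions enter through their complex embedding, so that a
single closure calculus serves both kinds of functions. *)
Lemma blip_real_comp (G : R -> R) (K : R) (f : X -> R) :
  (forall a b, `|G a - G b| <= K * `|a - b|) ->
  blip D (fun x => rc (f x)) -> blip D (fun x => rc (G (f x))).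
Proof.
move=> hG [M [M0 f1 f2]].
have K0 : 0 <= K by have := hG 1 0; rewrite subr0 normr1 mulr1; apply: le_trans.
apply: (@blipI _ (`|G 0| + K * M) (K * M)).
  move=> x Dx; rewrite cmod_rc -[X in `|X|](subrK (G 0)) addrC.
  rewrite (le_trans (ler_normD _ _))// lerD2l (le_trans (hG _ _))// subr0.
  by rewrite ler_wpM2l// -cmod_rc f1.
move=> x y Dx Dy; rewrite -rcB cmod_rc (le_trans (hG _ _))// -mulrA ler_wpM2l//.
by rewrite -cmod_rc rcB f2.
Qed.

End closure.

Lemma sub_blip (X : gauged) (D E : X -> Prop) (f : X -> C) :
  (forall x, E x -> D x) -> blip D f -> blip E f.
Proof.
move=> s [M [M0 h1 h2]]; exists M; split => // [x /s /h1 //|x y /s Dx /s Dy].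
exact: h2.
Qed.

Lemma blip_comp (X Y : gauged) (D : X -> Prop) (E : Y -> Prop) (f : X -> Y)
    (g : Y -> C) :
  (forall x, D x -> E (f x)) -> lipm D f -> blip E g -> blip D (fun x => g (f x)).
Proof.
move=> s [M M0 hf] [N [N0 g1 g2]]; apply: (@blipI _ _ _ N (N * M)).
  by move=> x Dx; apply: g1; exact: s.
move=> x y Dx Dy; rewrite (le_trans (g2 _ _ (s _ Dx) (s _ Dy)))// -mulrA.
by rewrite ler_wpM2l ?hf.
Qed.

Lemma lipm_pair (X Y Z : gauged) (D : X -> Prop) (f : X -> Y) (g : X -> Z) :
  lipm D f -> lipm D g -> @lipm X (gauged_prod Y Z) D (fun x => (f x, g x)).
Proof.
move=> [M M0 hf] [N N0 hg]; exists (M + N); first exact: addr_ge0.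
by move=> x y Dx Dy /=; rewrite mulrDl lerD ?hf ?hg.
Qed.

Lemma lipm_id (X : gauged) (D : X -> Prop) : lipm D id.
Proof. by exists 1 => // x y _ _; rewrite mul1r. Qed.

Lemma lipm_fst (X Y : gauged) (D : gauged_prod X Y -> Prop) :
  @lipm (gauged_prod X Y) X D fst.
Proof. by exists 1 => // x y _ _; rewrite mul1r lerDl gdist_ge0. Qed.

Lemma lipm_snd (X Y : gauged) (D : gauged_prod X Y -> Prop) :
  @lipm (gauged_prod X Y) Y D snd.
Proof. by exists 1 => // x y _ _; rewrite mul1r lerDr gdist_ge0. Qed.

Lemma lipm_comp (X Y Z : gauged) (D : X -> Prop) (E : Y -> Prop)
    (f : X -> Y) (g : Y -> Z) :
  (forall x, D x -> E (f x)) -> lipm D f -> lipm E g ->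
  lipm D (fun x => g (f x)).
Proof.
move=> s [M M0 hf] [N N0 hg]; exists (N * M); first exact: mulr_ge0.
move=> x y Dx Dy; rewrite (le_trans (hg _ _ (s _ Dx) (s _ Dy)))// -mulrA.
by rewrite ler_wpM2l ?hf.
Qed.

Lemma blip_lipm (X : gauged) (D : X -> Prop) (f : X -> C) r :
  (forall x, D x -> cmod (f x) <= r) -> @lipm X gauged_C D f -> blip D f.
Proof. by move=> hr [M M0 h]; apply: (blipI hr h). Qed.

Lemma blip_row (X : gauged) (D : X -> Prop) n (f : X -> 'rV[C]_n) :
  (forall i, blip D (fun x => f x 0 i)) ->
  exists M, [/\ 0 <= M, forall x, D x -> norm1 (f x) <= M &
    forall x y, D x -> D y -> norm1 (f x - f y) <= M * gdist x y].
Proof.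
move=> /choice[M hM]; exists (\sum_i M i); split.
- by apply: sumr_ge0 => i _; case: (hM i).
- by move=> x Dx; apply: ler_sum => i _; case: (hM i) => _ + _; exact.
move=> x y Dx Dy; rewrite mulr_suml; apply: ler_sum => i _.
by rewrite !mxE; case: (hM i) => _ _; exact.
Qed.

Lemma lipm_row (X : gauged) (D : X -> Prop) n (f : X -> 'rV[C]_n) :
  (forall i, blip D (fun x => f x 0 i)) -> @lipm X (gauged_row n) D f.
Proof. by move=> /blip_row[M [M0 _ h]]; exists M. Qed.

Lemma blip_coord (X : gauged) (D : X -> Prop) n (f : X -> 'rV[C]_n) r i :
  (forall x, D x -> norm1 (f x) <= r) -> @lipm X (gauged_row n) D f ->
  blip D (fun x => f x 0 i).
Proof.
move=> hr [M M0 h]; apply: (@blipI _ _ _ r M) => [x Dx|x y Dx Dy].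
  exact: le_trans (cmod_le_norm1 _ _) (hr _ Dx).
apply: le_trans (h _ _ Dx Dy); have := cmod_le_norm1 (f x - f y) i.
by rewrite !mxE.
Qed.

Lemma le_geometric (a b K : R) : (forall k, a <= b + K / 2 ^+ k) -> a <= b.
Proof.
move=> h; rewrite leNgt; apply/negP => ba.
have d0 : 0 < a - b by rewrite subr_gt0.
have [k hk] : exists k : nat, K / (a - b) < k%:R.
  exists (Num.truncn (`|K| / (a - b))).+1.
  apply: le_lt_trans (truncnS_gt _); rewrite ler_wpM2r ?ler_norm//.
  by rewrite invr_ge0 ltW.
have k2 : (k%:R : R) <= 2 ^+ k by rewrite -natrX ler_nat ltnW// ltn_expl.
have := h k; rewrite -lerBlDl; apply/negP; rewrite -ltNge.
rewrite ltr_pdivrMr ?exprn_gt0// -ltr_pdivrMl// mulrC.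
exact: lt_le_trans hk k2.
Qed.

(** For |t| at most tau = 1/(2(M+1)), with M a bound and Lipschitz constant of
B, the map w |-> A x + t B(x, w) sends the ball of radius r into itself and
halves distances there: Picard iteration converges geometrically. Comparing the
fixed points at x and at y, the contraction absorbs half of the distance
between them and leaves a multiple of the distance from x to y. *)
Lemma parametric_fixpoint (X : gauged) (D : X -> Prop) n (t : X -> C)
    (A : X -> 'rV[C]_n) (B : X * 'rV[C]_n -> 'rV[C]_n) (r : R) :
  blip D t ->
  (forall i, blip D (fun x => A x 0 i)) ->
  (forall i, @blip (gauged_prod X (gauged_row n)) (fun q => D q.1 /\ norm1 q.2 <= r)
     (fun q => B q 0 i)) ->
  (forall x, D x -> norm1 (A x) <= r - 1) ->
  exists2 tau, 0 < tau & exists v : X -> 'rV[C]_n,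
    (forall x, D x -> cmod (t x) <= tau ->
      [/\ norm1 (v x) <= r, v x = A x + t x *: B (x, v x) &
          forall w, norm1 w <= r -> w = A x + t x *: B (x, w) -> w = v x]) /\
    forall i, blip (fun x => D x /\ cmod (t x) <= tau) (fun x => v x 0 i).
Proof.
move=> [Mt [Mt0 _ t2]] /blip_row[MA [MA0 _ A2]] /blip_row[M [M0 B1 B2]] Ar.
pose tau := (2 * (M + 1))^-1.
have tau0 : 0 < tau by rewrite invr_gt0; lra.
have tauM : tau * M <= 1 / 2 by rewrite /tau ler_pdivrMl; lra.
pose T x w := A x + t x *: B (x, w).
have TT x w w' : D x -> cmod (t x) <= tau -> norm1 w <= r -> norm1 w' <= r ->
    norm1 (T x w - T x w') <= 2^-1 * norm1 (w - w').
  move=> Dx tx hw hw'.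
  have -> : T x w - T x w' = t x *: (B (x, w) - B (x, w')).
    by rewrite /T scalerBr; apply/rowP => i; rewrite !mxE; ring.
  rewrite norm1Z; have := B2 (x, w) (x, w') (conj Dx hw) (conj Dx hw').
  rewrite /= gdistxx add0r => b.
  rewrite (le_trans (ler_pM (cmod_ge0 _) (norm1_ge0 _) tx b))// mulrA.
  by rewrite ler_wpM2r ?norm1_ge0//; lra.
have Tr x w : D x -> cmod (t x) <= tau -> norm1 w <= r -> norm1 (T x w) <= r.
  move=> Dx tx hw; rewrite /T (le_trans (norm1D _ _))// norm1Z.
  have := Ar _ Dx; have := ler_pM (cmod_ge0 _) (norm1_ge0 _) tx (B1 (x, w) (conj Dx hw)).
  by move: tauM; lra.
have uniq x w w' : D x -> cmod (t x) <= tau -> norm1 w <= r -> norm1 w' <= r ->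
    w = T x w -> w' = T x w' -> w = w'.
  move=> Dx tx hw hw' e e'; apply/eqP; rewrite -subr_eq0; apply/eqP.
  apply: norm1_eq0; have := TT x _ _ Dx tx hw hw'; rewrite -e -e'.
  by have := norm1_ge0 (w - w'); lra.
have sol x : exists v, D x -> cmod (t x) <= tau -> norm1 v <= r /\ v = T x v.
  have [[Dx tx]|nD] := pselect (D x /\ cmod (t x) <= tau); last first.
    by exists 0 => Dx tx; case: nD.
  have r0 : 0 <= r by have := Ar _ Dx; have := norm1_ge0 (A x); lra.
  pose u k := iter k (T x) 0.
  have ur k : norm1 (u k) <= r by elim: k => [|k IH]; rewrite ?norm10//; apply: Tr.
  have [|l [K hl]] := @row_geometric_limit R n u r.
    elim=> [|k IH].
      by rewrite expr0 divr1 /u /= sub0r norm1N Tr// norm10.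
    apply: le_trans (TT x _ _ Dx tx (ur k) (ur k.+1)) _.
    rewrite exprS invfM mulrCA ler_wpM2l// invr_ge0; lra.
  have lr : norm1 l <= r.
    apply: (@le_geometric _ _ K) => k.
    by rewrite -[l](subrK (u k)) addrC (le_trans (norm1D _ _))// lerD// norm1B.
  exists l => _ _; split => //; apply/eqP; rewrite -subr_eq0; apply/eqP.
  apply: norm1_eq0; apply: le_anti; rewrite norm1_ge0 andbT.
  apply: (@le_geometric _ _ K) => k.
  have -> : l - T x l = (l - u k.+1) + (T x (u k) - T x l).
    by rewrite addrA subrK.
  rewrite add0r (le_trans (norm1D _ _))//.
  have h1 := hl k.+1; have h2 := TT x _ _ Dx tx (ur k) lr.
  have h3 : 2^-1 * norm1 (u k - l) <= 2^-1 * (K / 2 ^+ k).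
    by rewrite ler_wpM2l ?invr_ge0.
  have e : K / 2 ^+ k = K / 2 ^+ k.+1 + 2^-1 * (K / 2 ^+ k).
    by rewrite exprS; field; rewrite expf_neq0.
  rewrite e; rewrite norm1B in h1; exact: lerD h1 (le_trans h2 h3).
have [v hv] := choice sol.
exists tau => //; exists v; split.
  move=> x Dx tx; have [vr ve] := hv x Dx tx; split => // w hw e.
  exact: uniq Dx tx hw vr e ve.
pose L := 2 * (MA + Mt * M + tau * M).
move=> i; apply: (@blipI _ _ _ r L) => [x [Dx tx]|x y [Dx tx] [Dy ty]].
  by have [vr _] := hv x Dx tx; apply: le_trans (cmod_le_norm1 _ _) vr.
have [vxr vx] := hv x Dx tx; have [vyr vy] := hv y Dy ty.
apply: (@le_trans _ _ (norm1 (v x - v y))).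
  by have := cmod_le_norm1 (v x - v y) i; rewrite !mxE.
have e : v x - v y = (A x - A y) + ((t x - t y) *: B (x, v x) +
    t y *: (B (x, v x) - B (y, v y))).
  by rewrite {1}vx {1}vy /T; apply/rowP => j; rewrite !mxE; ring.
have h1 := A2 _ _ Dx Dy.
have h2 := ler_pM (cmod_ge0 _) (norm1_ge0 _) (t2 _ _ Dx Dy) (B1 (x, v x) (conj Dx vxr)).
have h3 := ler_pM (cmod_ge0 _) (norm1_ge0 _) ty
  (B2 (x, v x) (y, v y) (conj Dx vxr) (conj Dy vyr)).
have h : norm1 (v x - v y) <= MA * gdist x y + (Mt * gdist x y * M +
    tau * (M * (gdist x y + norm1 (v x - v y)))).
  rewrite {1}e (le_trans (norm1D _ _))// lerD// (le_trans (norm1D _ _))//.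
  by rewrite !norm1Z lerD.
have h4 : tau * M * norm1 (v x - v y) <= 1 / 2 * norm1 (v x - v y).
  by rewrite ler_wpM2r ?norm1_ge0.
by rewrite /L; lra.
Qed.

End bounded_lipschitz.

(** * From estimates to topology *)

Section topology.
Variable R : realType.
Local Notation C := (Cplx R).

Lemma lt_rc (z : C) (e : R) : (`|z| < rc e) = (cmod z < e).
Proof. by rewrite cmodE ltcR. Qed.

Lemma pos_rc (e : C) : 0 < e -> exists2 r : R, 0 < r & e = rc r.
Proof.
case: e => a b; rewrite ltcE /= => /andP[/eqP b0 a0].
by exists a => //; rewrite b0.
Qed.

Lemma nbhs_C (z : C) (e : R) : 0 < e -> nbhs z [set w : C | cmod (z - w) < e].
Proof.
move=> e0; apply/nbhs_ballP; exists (rc e); first by rewrite /= ltcR.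
by move=> w; rewrite /ball /= lt_rc.
Qed.

Lemma nbhs_rV n (v : 'rV[C]_n) (e : R) : 0 < e ->
  nbhs v [set w : 'rV[C]_n | norm1 (v - w) < e].
Proof.
move=> e0; apply/nbhs_ballP.
have n0 : 0 < (n.+1)%:R :> R by rewrite ltr0n.
exists (rc (e / n.+1%:R)); first by rewrite /= ltcR divr_gt0.
move=> w hw /=; apply: (@le_lt_trans _ _ (\sum_(i < n) e / n.+1%:R)).
  apply: ler_sum => i _; rewrite !mxE ltW// -lt_rc; by case: hw => _; apply.
rewrite sumr_const card_ord -[ltLHS]mulr_natr mulrAC -mulrA gtr_pMr//.
by rewrite ltr_pdivrMr// mul1r ltr_nat.
Qed.

Lemma nbhs_C_rV n (p : C * 'rV[C]_n) (e : R) : 0 < e ->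
  nbhs p [set q : C * 'rV[C]_n |
    gdist (p : gauged_prod (gauged_C R) (gauged_row R n)) q < e].
Proof.
move=> e0; have e2 : 0 < e / 2 by rewrite divr_gt0.
exists ([set w | cmod (p.1 - w) < e / 2], [set w | norm1 (p.2 - w) < e / 2]).
  by split; [exact: nbhs_C | exact: nbhs_rV].
by move=> q [/= h1 h2]; lra.
Qed.

(** The abstract d covers both C^3 and C x C^3 as domains. *)
Lemma within_continuous_gauge (T : topologicalType) (d : T -> T -> R) n
    (A : set T) (f : T -> 'rV[C]_n) :
  (forall x (e : R), 0 < e -> nbhs x [set y | d x y < e]) ->
  (forall x, A x -> forall e : R, 0 < e ->
     exists2 r, 0 < r & forall y, A y -> d x y < r -> norm1 (f x - f y) < e) ->
  {within A, continuous f}.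
Proof.
move=> hd hf; apply/subspace_continuousP => x Ax.
apply/cvg_ballP => e' /pos_rc[e e0 ->] /=.
have [r r0 hr] := hf _ Ax _ e0.
rewrite nearE /within /=; apply: filterS (hd x r r0) => y /= dxy Ay.
have h := hr _ Ay dxy; split; first by rewrite ltcR.
move=> i j; rewrite /ball /= lt_rc ord1; apply: le_lt_trans h.
by have := cmod_le_norm1 (f x - f y) j; rewrite !mxE.
Qed.

(** Splitting coordinates into real and imaginary parts puts the ball inside
the image of a compact cube of R^(2n), on which the continuous function attains
its minimum. *)
Lemma positive_lower_bound n (f : 'rV[C]_n -> R) (r : R) :
  (forall r', @blip R (gauged_row R n) (fun v => norm1 v <= r') (fun v => rc (f v))) ->
  (forall v, 0 < f v) ->
  exists2 c, 0 < c & forall v, norm1 v <= r -> c <= f v.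
Proof.
move=> hf f0; have [r0|r0] := ltP r 0.
  by exists 1 => // v; have := norm1_ge0 v; lra.
pose k (w : 'rV[R]_(n + n)) : 'rV[C]_n :=
  \row_i (w 0 (lshift n i) +i* w 0 (rshift n i)).
have kB w w' : norm1 (k w - k w') <= (n%:R * 2) * `|w - w'|.
  rewrite /norm1 (@le_trans _ _ (\sum_(i < n) 2 * `|w - w'|))//; last first.
    by rewrite sumr_const card_ord -[leLHS]mulr_natl mulrA.
  apply: ler_sum => i _; rewrite !mxE; apply: le_trans (cmod_le_ReIm _) _ => /=.
  have h j : `|w 0 j - w' 0 j| <= `|w - w'|.
    have -> : w 0 j - w' 0 j = (w - w') 0 j by rewrite !mxE.
    by rewrite {2}/Num.norm /= mx_normrE; apply/bigmax_geP; right => /=; exists (0, j).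
  by rewrite (le_trans (lerD (h _) (h _)))//; lra.
have k0 : k 0 = 0 by apply/rowP => i; rewrite !mxE.
pose A := [set w : 'rV[R]_(n + n) | `|w| <= r].
have kA w : A w -> norm1 (k w) <= n%:R * 2 * r.
  move=> /= wr; have := kB w 0; rewrite k0 !subr0 => h; apply: le_trans h _.
  by rewrite ler_wpM2l ?mulr_ge0.
have [M [M0 _ fM]] := hf (n%:R * 2 * r).
have cA : compact A.
  apply: bounded_closed_compact.
    by exists r; split; [exact: num_real|move=> x rx w /= wr; rewrite (le_trans wr)// ltW].
  have -> : A = closed_ball_ Num.norm (0 : 'rV[R]_(n+n)) r.
    by apply/seteqP; split => w; rewrite /closed_ball_ /= sub0r normrN.
  exact: closed_closed_ball_.
have fA : {within A, continuous (fun w => f (k w))}.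
  apply/subspace_continuousP => w Aw; apply/cvgrPdist_lt => e e0.
  rewrite nearE /within /=.
  pose L := M * (n%:R * 2) + 1.
  have L0 : 0 < L by rewrite ltr_wpDl// !mulr_ge0.
  have : nbhs w (ball w (e / L)) by apply: nbhsx_ballx; rewrite divr_gt0.
  apply: filterS => w'; rewrite -ball_normE /= => hw Aw'.
  have := fM (k w) (k w') (kA _ Aw) (kA _ Aw'); rewrite -rcB cmod_rc => h.
  apply: le_lt_trans h _; rewrite ltr_pdivlMr// in hw.
  apply: le_lt_trans (ler_wpM2l M0 (kB w w')) _; apply: le_lt_trans hw.
  by rewrite mulrA mulrC ler_wpM2l// /L lerDl.
have A0 : A !=set0 by exists 0; rewrite /A /= normr0.
have [w _ wmin] := EVT_min_rV A0 cA fA.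
exists (f (k w)) => // v vr.
pose u : 'rV[R]_(n + n) :=
  row_mx (map_mx (@complex.Re R) (v : 'rV[R[i]]_n))
    (map_mx (@complex.Im R) (v : 'rV[R[i]]_n)).
have -> : v = k u.
  apply/rowP => i; rewrite mxE /u row_mxEl row_mxEr !mxE.
  by case: (v 0 i).
apply: wmin; rewrite inE /A /= {1}/Num.norm /= mx_normrE.
apply/bigmax_leP; split => // -[i j] _ /=; rewrite ord1 /u.
case: (split_ordP j) => l ->; rewrite ?row_mxEl ?row_mxEr !mxE.
  by apply: le_trans vr; apply: le_trans (cmod_le_norm1 _ l); exact: cmod_ge_Re.
by apply: le_trans vr; apply: le_trans (cmod_le_norm1 _ l); exact: cmod_ge_Im.
Qed.

End topology.

(** * Algebra of the family *)

(** If z <> 0 the first two equations give x = y = 0 and the last one fails. If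
z = 0, then y^10 = (3/2) x^15 turns the last equation into
(25/4) x^30 = x^12 y^12, whose fifth power reads
(25/4)^5 x^150 = (3/2)^6 x^150; the two constants differ, so x = 0. *)
Lemma no_common_zero (K : numFieldType) (x y z : K) :
  z ^+ 5 * x = 0 -> z ^+ 5 * y = 0 -> 15 * x ^+ 15 = 10 * y ^+ 10 ->
  (x ^+ 15 + y ^+ 10 + z ^+ 6) ^+ 2 = (x * y) ^+ 12 ->
  [/\ x = 0, y = 0 & z = 0].
Proof.
move=> zx zy xy F0.
have [z0|z0] := eqVneq z 0; last first.
  have z5 : z ^+ 5 != 0 by rewrite expf_neq0.
  have x0 : x = 0 by apply: (mulfI z5); rewrite mulr0.
  have y0 : y = 0 by apply: (mulfI z5); rewrite mulr0.
  move: F0; rewrite x0 y0 mul0r !expr0n /= !add0r -exprM => /eqP.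
  by rewrite expf_eq0 (negPf z0).
have e1 : y ^+ 10 = 3 / 2 * x ^+ 15.
  have -> : y ^+ 10 = (10 * y ^+ 10) / 10 by field.
  by rewrite -xy; field.
have e2 : 25 / 4 * x ^+ 30 = x ^+ 12 * y ^+ 12.
  by rewrite -exprMn -F0 z0 e1 [0 ^+ 6]expr0n addr0 [x ^+ 30](exprM x 15 2); field.
have e3 : (25 / 4) ^+ 5 * x ^+ 150 = (3 / 2) ^+ 6 * x ^+ 150.
  have -> : (25 / 4) ^+ 5 * x ^+ 150 = (25 / 4 * x ^+ 30) ^+ 5.
    by rewrite [RHS]exprMn -exprM.
  rewrite e2 exprMn -!exprM (exprM y 10 6) e1 exprMn -exprM mulrCA -exprD.
  by [].
have x0 : x = 0.
  apply/eqP; move/eqP: e3; rewrite -subr_eq0 -mulrBl mulf_eq0 => /orP[|].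
    have -> : (3 / 2) ^+ 6 = (9 / 4) ^+ 3 :> K by field.
    have l1 : (9 / 4) ^+ 3 < (25 / 4) ^+ 3 :> K.
      by rewrite ltr_pXn2r ?nnegrE ?divr_ge0 ?ler0n// ltr_pM2r ?invr_gt0 ?ltr0n// ltr_nat.
    have l2 : (25 / 4) ^+ 3 < (25 / 4) ^+ 5 :> K.
      by rewrite ltr_eXn2l// ltr_pdivlMr ?ltr0n// mul1r ltr_nat.
    by rewrite subr_eq0 (gt_eqF (lt_trans l1 l2)).
  by rewrite expf_eq0.
split => //; apply/eqP; move/eqP: e1.
by rewrite x0 [0 ^+ 15]expr0n mulr0 expf_eq0.
Qed.

Lemma rowDE (K : zmodType) n (a b : 'rV[K]_n) i : (a + b) 0 i = a 0 i + b 0 i.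
Proof. by rewrite mxE. Qed.

Lemma rowZE (K : pzRingType) n k (a : 'rV[K]_n) i : (k *: a) 0 i = k * a 0 i.
Proof. by rewrite mxE. Qed.

Section geometry.
Variable R : realType.
Local Notation C := (Cplx R).
Local Notation V := 'rV[C]_3.
Implicit Types (p v a b : V) (t : C).

Lemma ord3_ind (P : 'I_3 -> Prop) : P 0 -> P 1 -> P 2 -> forall i, P i.
Proof.
move=> P0 P1 P2; case=> [[|[|[|//]]]] h.
- by have -> : Ordinal h = 0 by apply: val_inj.
- by have -> : Ordinal h = 1 by apply: val_inj.
- by have -> : Ordinal h = 2 by apply: val_inj.
Qed.

Lemma eq_row3 a b : a 0 0 = b 0 0 -> a 0 1 = b 0 1 -> a 0 2 = b 0 2 -> a = b.
Proof. by move=> h0 h1 h2; apply/rowP; apply: ord3_ind. Qed.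

Definition vec (x y z : C) : V := \row_(i < 3) nth 0 [:: x; y; z] i.

Lemma vec0 x y z : vec x y z 0 0 = x. Proof. by rewrite mxE. Qed.
Lemma vec1 x y z : vec x y z 0 1 = y. Proof. by rewrite mxE. Qed.
Lemma vec2 x y z : vec x y z 0 2 = z. Proof. by rewrite mxE. Qed.
Definition vecE := (vec0, vec1, vec2).

Definition dot a b : C := a 0 0 * b 0 0 + a 0 1 * b 0 1 + a 0 2 * b 0 2.

Definition cross a b : V :=
  vec (a 0 1 * b 0 2 - a 0 2 * b 0 1)
      (a 0 2 * b 0 0 - a 0 0 * b 0 2)
      (a 0 0 * b 0 1 - a 0 1 * b 0 0).

(** Together with the next three identities: crossing with the conjugate c of the
vector of minors a x b yields a pair dual to (a, b), up to the factor
|a x b|^2. *)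
Lemma dot_crossl a b c : dot a (cross b c) = dot (cross a b) c.
Proof. by rewrite /dot /cross !vecE; ring. Qed.

Lemma dot_crossr a b c : dot b (cross c a) = dot (cross a b) c.
Proof. by rewrite /dot /cross !vecE; ring. Qed.

Lemma dot_cross0l a c : dot a (cross a c) = 0.
Proof. by rewrite /dot /cross !vecE; ring. Qed.

Lemma dot_cross0r a c : dot a (cross c a) = 0.
Proof. by rewrite /dot /cross !vecE; ring. Qed.

Lemma dotD a b c : dot a (b + c) = dot a b + dot a c.
Proof. by rewrite /dot !mxE; ring. Qed.

Lemma dotZ a k b : dot a (k *: b) = k * dot a b.
Proof. by rewrite /dot !mxE; ring. Qed.

(** The remainder quotient in the first order Taylor formula of the n-th power:
(a + u)^n = a^n + n a^(n-1) u + u^2 (taylor2 n a u). *)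
Fixpoint taylor2 n (a u : C) : C :=
  if n is m.+1 then m%:R * a ^+ m.-1 + (a + u) * taylor2 m a u else 0.
Arguments taylor2 : simpl never.

Lemma taylor2S n (a u : C) :
  taylor2 n.+1 a u = n%:R * a ^+ n.-1 + (a + u) * taylor2 n a u.
Proof. by []. Qed.

Lemma taylor2E n (a u : C) :
  (a + u) ^+ n = a ^+ n + n%:R * a ^+ n.-1 * u + u ^+ 2 * taylor2 n a u.
Proof.
elim: n => [|n IH]; first by rewrite !expr0 /taylor2; ring.
rewrite exprS IH taylor2S -natr1; case: n {IH} => [|n] /=; rewrite ?exprS ?expr0; ring.
Qed.

Definition df p : V := vec (15 * p 0 0 ^+ 14) (10 * p 0 1 ^+ 9) (6 * p 0 2 ^+ 5).

(** The differential of g_0, not of g_t: the linear term t z is treated as part of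
the perturbation. *)
Definition dg p : V := vec (p 0 1) (p 0 0) 0.
Definition minors p : V := cross (df p) (dg p).
Definition conj_row a : V := vec (cj (a 0 0)) (cj (a 0 1)) (cj (a 0 2)).

(** By the Cauchy-Binet formula this sum of squared minors is the Gram
determinant of the differentials of f and g_0; it vanishes exactly at the
critical points of (f, g_0). *)
Definition gram p : R :=
  cmod (minors p 0 0) ^+ 2 + cmod (minors p 0 1) ^+ 2 + cmod (minors p 0 2) ^+ 2.

(** Tangent to the levels of g_0, with derivative of f equal to the Gram
determinant; symmetrically for the next direction. *)
Definition f_dir p : V := cross (dg p) (conj_row (minors p)).
Definition g_dir p : V := cross (conj_row (minors p)) (df p).

Lemma dot_minors p : dot (minors p) (conj_row (minors p)) = rc (gram p).
Proof. by rewrite /dot /gram !vecE !mulcj !rcD. Qed.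

Lemma gram_ge0 p : 0 <= gram p.
Proof. by rewrite !addr_ge0 ?exprn_ge0 ?cmod_ge0. Qed.

(** The terms of order at least two of f(p + t v), divided by t^2; the next
definition does the same for g_t(p + t v). *)
Definition f_rem t p v : C :=
  v 0 0 ^+ 2 * taylor2 15 (p 0 0) (t * v 0 0)
  + v 0 1 ^+ 2 * taylor2 10 (p 0 1) (t * v 0 1)
  + v 0 2 ^+ 2 * taylor2 6 (p 0 2) (t * v 0 2).

Definition g_rem v : C := v 0 0 * v 0 1 + v 0 2.

(** The difference quotients (f(p + t v) - f(p)) / t,
(g_t(p + t v) - g_0(p)) / t and (F_t(p + t v) - F_0(p)) / t, written as
polynomials so that they make sense and are Lipschitz at t = 0 too. *)
Definition f_incr t p v : C := dot (df p) v + t * f_rem t p v.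
Definition g_incr t p v : C := dot (dg p) v + p 0 2 + t * g_rem v.
Definition F_incr t p v : C :=
  let f := f_fun p in let g := g_fun 0 p in
  2 * f * f_incr t p v + t * f_incr t p v ^+ 2
  - (12 * g ^+ 11 * g_incr t p v
     + t * g_incr t p v ^+ 2 * taylor2 12 g (t * g_incr t p v)).

Lemma f_shift t p v : f_fun (p + t *: v) = f_fun p + t * f_incr t p v.
Proof.
rewrite /f_fun /f_incr /f_rem /dot /df !vecE !mxE !taylor2E /=.
by move: (taylor2 15 _ _) (taylor2 10 _ _) (taylor2 6 _ _) => a b c; ring.
Qed.

Lemma g_shift t p v : g_fun t (p + t *: v) = g_fun 0 p + t * g_incr t p v.
Proof. by rewrite /g_fun /g_incr /g_rem /dot /dg !vecE !mxE; ring. Qed.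

Lemma F_shift t p v : F_fun t (p + t *: v) = F_fun 0 p + t * F_incr t p v.
Proof.
rewrite /F_fun f_shift g_shift (taylor2E 12) /F_incr /=.
move: (taylor2 _ _ _) => q.
move: (f_fun p) (g_fun 0 p) (f_incr t p v) (g_incr t p v) => f g a b.
by ring.
Qed.

(** Solving f_incr = 0 and g_incr = 0 for the linear terms in v, along the
directions f_dir and g_dir, gives v = step0 + t step1(v), a fixed point equation
whose dependence on v carries a factor t. The Gram determinant in the
denominator is replaced by its maximum with c, which keeps the equation Lipschitz
on all of C^3. *)
Definition step0 (c : R) p : V := (- (p 0 2 * rc (Num.max (gram p) c)^-1)) *: g_dir p.
Definition step1 (c : R) t p v : V :=
  (- rc (Num.max (gram p) c)^-1) *: (f_rem t p v *: f_dir p + g_rem v *: g_dir p).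

(** Where the truncation is inactive, the solution v makes f_incr and g_incr
vanish: f(p + t v) = f(p) and g_t(p + t v) = g_0(p). *)
Lemma F_incr_eq0 (c : R) t p v : 0 < c -> c <= gram p ->
  v = step0 c p + t *: step1 c t p v -> F_incr t p v = 0.
Proof.
move=> c0 cd; rewrite /step0 /step1 max_l// => hv.
have d0 : rc (gram p) != 0.
  by apply/negP => /eqP/(@rc_inj R) d; move: cd; rewrite d leNgt c0.
have hf : f_incr t p v = 0.
  rewrite /f_incr {1}hv !(dotD, dotZ) /f_dir /g_dir dot_cross0r dot_crossl dot_minors rcV.
  by field.
have hg : g_incr t p v = 0.
  rewrite /g_incr {1}hv !(dotD, dotZ) /f_dir /g_dir dot_cross0l dot_crossr dot_minors rcV.
  by field.
by rewrite /F_incr hf hg /=; ring.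
Qed.

Lemma F_gram_eq0 p : F_fun 0 p = 0 -> gram p = 0 -> p = 0.
Proof.
move=> F0 d0.
have sq0 i : i \in [:: 0; 1; 2] -> minors p 0 i = 0.
  move=> hi; apply: cmod_eq0; apply/eqP; rewrite -sqrf_eq0; apply/eqP.
  move: hi d0; rewrite /gram.
  have := sqr_ge0 (cmod (minors p 0 0)); have := sqr_ge0 (cmod (minors p 0 1)).
  have := sqr_ge0 (cmod (minors p 0 2)).
  by rewrite !inE => h1 h2 h3 /or3P[] /eqP-> ?; lra.
have := sq0 2 isT; have := sq0 1 isT; have := sq0 0 isT.
rewrite /minors /cross /df /dg !vecE; move: F0; rewrite /F_fun /f_fun /g_fun.
move=> F0 c0 c1 c2.
have n0 n : (n.+1%:R : C) != 0 by rewrite pnatr_eq0.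
have [||||x0 y0 z0] := @no_common_zero C (p 0 0) (p 0 1) (p 0 2).
- by apply: (mulfI (n0 5)); rewrite mulr0 -[RHS](oppr0) -[in RHS]c0; ring.
- by apply: (mulfI (n0 5)); rewrite mulr0 -[RHS]c1; ring.
- by apply/eqP; rewrite -subr_eq0; apply/eqP; rewrite -[RHS]c2; ring.
- by apply/eqP; rewrite -subr_eq0; apply/eqP; rewrite -[RHS]F0; ring.
by apply: eq_row3; rewrite mxE.
Qed.

End geometry.

(** * Lipschitz estimates and uniform submersivity *)

Section regularity_closure.
Variable R : realType.
Local Notation C := (Cplx R).

Definition blipv (X : gauged R) (D : X -> Prop) n (f : X -> 'rV[C]_n) :=
  forall i, blip D (fun x => f x 0 i).

(** 1/u - 1/w = (w - u)/(uw), and truncation is 1-Lipschitz. *)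
Lemma lip_invmax (c : R) : 0 < c -> forall a b : R,
  `|(Num.max a c)^-1 - (Num.max b c)^-1| <= (c ^+ 2)^-1 * `|a - b|.
Proof.
move=> c0 a b; set u := Num.max a c; set w := Num.max b c.
have uc : c <= u by rewrite le_max lexx orbT.
have wc : c <= w by rewrite le_max lexx orbT.
have u0 : 0 < u by exact: lt_le_trans uc.
have w0 : 0 < w by exact: lt_le_trans wc.
have uw : `|w - u| <= `|a - b|.
  rewrite distrC /u /w; case: (leP a c) => ac; case: (leP b c) => bc.
  - by rewrite subrr normr0.
  - by rewrite !ltr0_norm; lra.
  - by rewrite !gtr0_norm; lra.
  - by [].
have -> : u^-1 - w^-1 = (u * w)^-1 * (w - u) by field; rewrite !gt_eqF.
have uw0 : 0 < u * w by exact: mulr_gt0.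
rewrite normrM gtr0_norm ?invr_gt0//.
rewrite ler_pM ?normr_ge0 ?invr_ge0 ?(ltW uw0)//.
by rewrite lef_pV2 ?posrE ?mulr_gt0 ?exprn_gt0// expr2 ler_pM ?(ltW c0).
Qed.

Section closure.
Variables (X : gauged R) (D : X -> Prop).

Lemma blip_taylor2 n (a u : X -> C) : blip D a -> blip D u ->
  blip D (fun x => taylor2 n (a x) (u x)).
Proof.
move=> ha hu; elim: n => [|n IH]; first exact: blip_cst.
apply: (@eq_blip _ _ _ (fun x => n%:R * a x ^+ n.-1
    + (a x + u x) * taylor2 n (a x) (u x))).
  by move=> x _; rewrite taylor2S.
apply: blipD; apply: blipM => //; first exact: blip_cst.
  exact: blipX.
exact: blipD.
Qed.

Lemma blip_invmax (c : R) (f : X -> R) : 0 < c ->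
  blip D (fun x => rc (f x)) -> blip D (fun x => rc (Num.max (f x) c)^-1).
Proof. by move=> c0 hf; exact: (blip_real_comp (lip_invmax c0) hf). Qed.

Lemma blip_rcD (f g : X -> R) : blip D (fun x => rc (f x)) ->
  blip D (fun x => rc (g x)) -> blip D (fun x => rc (f x + g x)).
Proof.
move=> hf hg; apply: (@eq_blip _ _ _ (fun x => rc (f x) + rc (g x))).
  by move=> x _; rewrite rcD.
exact: blipD.
Qed.

Lemma blip_rcX (f : X -> R) n : blip D (fun x => rc (f x)) ->
  blip D (fun x => rc (f x ^+ n)).
Proof.
move=> hf; apply: (@eq_blip _ _ _ (fun x => rc (f x) ^+ n)).
  by move=> x _; rewrite rcX.
exact: blipX.
Qed.

Lemma blipv_vec (f g h : X -> C) : blip D f -> blip D g -> blip D h ->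
  blipv D (fun x => vec (f x) (g x) (h x)).
Proof.
move=> hf hg hh; apply: ord3_ind.
- by apply: eq_blip hf => x _; rewrite vec0.
- by apply: eq_blip hg => x _; rewrite vec1.
- by apply: eq_blip hh => x _; rewrite vec2.
Qed.

Lemma blipvD n (f g : X -> 'rV[C]_n) : blipv D f -> blipv D g ->
  blipv D (fun x => f x + g x).
Proof.
move=> hf hg i; apply: (@eq_blip _ _ _ (fun x => f x 0 i + g x 0 i)).
  by move=> x _; rewrite mxE.
exact: blipD.
Qed.

Lemma blipvN n (f : X -> 'rV[C]_n) : blipv D f -> blipv D (fun x => - f x).
Proof.
move=> hf i; apply: (@eq_blip _ _ _ (fun x => - f x 0 i)).
  by move=> x _; rewrite mxE.
exact: blipN.
Qed.

Lemma blipvZ n (k : X -> C) (f : X -> 'rV[C]_n) : blip D k -> blipv D f ->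
  blipv D (fun x => k x *: f x).
Proof.
move=> hk hf i; apply: (@eq_blip _ _ _ (fun x => k x * f x 0 i)).
  by move=> x _; rewrite mxE.
exact: blipM.
Qed.

Lemma blipv_const n (f : X -> C) : blip D f ->
  blipv D (fun x => \row_(i < n) f x).
Proof. by move=> hf i; apply: eq_blip hf => x _; rewrite mxE. Qed.

End closure.

End regularity_closure.

(** Proves that an explicit expression is bounded Lipschitz by recursion on its
shape, ending with the hypotheses of the context. *)
Ltac blips := repeat lazymatch goal with
  | H : ?G |- ?G => exact H
  | |- blip _ (fun x => @?f x + @?g x) => apply: (blipD (f := f) (g := g))
  | |- blip _ (fun x => - @?f x) => apply: (blipN (f := f))
  | |- blip _ (fun x => @?f x * @?g x) => apply: (blipM (f := f) (g := g))
  | |- blip _ (fun x => @?f x ^+ _) => apply: (@blipX _ _ _ f)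
  | |- blip _ (fun x => cj (@?f x)) => apply: (blip_cj (f := f))
  | |- blip _ (fun x => taylor2 _ (@?f x) (@?g x)) =>
      apply: (@blip_taylor2 _ _ _ _ f g)
  | |- blip _ (fun x => rc (cmod (@?f x))) => apply: (blip_cmod (f := f))
  | |- blip _ (fun x => rc (@?f x + @?g x)) =>
      apply: (blip_rcD (f := f) (g := g))
  | |- blip _ (fun x => rc (@?f x ^+ _)) => apply: (@blip_rcX _ _ _ f)
  | |- blip _ (fun x => rc (Num.max (@?f x) _)^-1) =>
      apply: (blip_invmax (f := f))
  | |- blipv _ (fun x => vec (@?f x) (@?g x) (@?h x)) =>
      apply: (blipv_vec (f := f) (g := g) (h := h))
  | |- blipv _ (fun x => - @?f x) => apply: (blipvN (f := f))
  | |- blipv _ (fun x => @?f x + @?g x) => apply: (blipvD (f := f) (g := g))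
  | |- blipv _ (fun x => @?k x *: @?f x) => apply: (blipvZ (k := k) (f := f))
  | |- blip _ (fun x => fun_of_matrix _ _ _) =>
      match goal with H : blipv _ _ |- _ => exact: (H _) end
  | |- blip _ _ => exact: blip_cst
  end.

Section regularity.
Variable R : realType.
Local Notation C := (Cplx R).
Local Notation V := 'rV[C]_3.

Section expressions.
Variables (X : gauged R) (D : X -> Prop) (t : X -> C) (p v : X -> V).
Hypotheses (ht : blip D t) (hp : blipv D p) (hv : blipv D v).

Lemma blip_dot (a b : X -> V) : blipv D a -> blipv D b ->
  blip D (fun x => dot (a x) (b x)).
Proof. by move=> ha hb; rewrite /dot; blips. Qed.

Lemma blipv_cross (a b : X -> V) : blipv D a -> blipv D b ->
  blipv D (fun x => cross (a x) (b x)).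
Proof. by move=> ha hb; rewrite /cross; blips. Qed.

Lemma blipv_df : blipv D (fun x => df (p x)).
Proof. by rewrite /df; blips. Qed.

Lemma blipv_dg : blipv D (fun x => dg (p x)).
Proof. by rewrite /dg; blips. Qed.

Lemma blipv_minors : blipv D (fun x => minors (p x)).
Proof. by apply: blipv_cross; [exact: blipv_df | exact: blipv_dg]. Qed.

Lemma blipv_conj_minors : blipv D (fun x => conj_row (minors (p x))).
Proof. by have h := blipv_minors; rewrite /conj_row; blips. Qed.

Lemma blip_gram : blip D (fun x => rc (gram (p x))).
Proof. by have h := blipv_minors; rewrite /gram; blips. Qed.

Lemma blipv_f_dir : blipv D (fun x => f_dir (p x)).
Proof. by apply: blipv_cross; [exact: blipv_dg | exact: blipv_conj_minors]. Qed.

Lemma blipv_g_dir : blipv D (fun x => g_dir (p x)).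
Proof. by apply: blipv_cross; [exact: blipv_conj_minors | exact: blipv_df]. Qed.

Lemma blip_f_rem : blip D (fun x => f_rem (t x) (p x) (v x)).
Proof. by rewrite /f_rem; blips. Qed.

Lemma blip_g_rem : blip D (fun x => g_rem (v x)).
Proof. by rewrite /g_rem; blips. Qed.

Lemma blip_f_incr : blip D (fun x => f_incr (t x) (p x) (v x)).
Proof.
have h1 := blip_f_rem; have h2 := blip_dot blipv_df hv.
by rewrite /f_incr; blips.
Qed.

Lemma blip_g_incr : blip D (fun x => g_incr (t x) (p x) (v x)).
Proof.
have h1 := blip_g_rem; have h2 := blip_dot blipv_dg hv.
by rewrite /g_incr; blips.
Qed.

Lemma blip_f : blip D (fun x => f_fun (p x)).
Proof. by rewrite /f_fun; blips. Qed.

Lemma blip_g : blip D (fun x => g_fun (t x) (p x)).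
Proof. by rewrite /g_fun; blips. Qed.

End expressions.

Section expressions2.
Variables (X : gauged R) (D : X -> Prop) (t : X -> C) (p v : X -> V).
Hypotheses (ht : blip D t) (hp : blipv D p) (hv : blipv D v).

Lemma blip_F : blip D (fun x => F_fun (t x) (p x)).
Proof.
by have h1 := blip_f hp; have h2 := blip_g ht hp; rewrite /F_fun; blips.
Qed.

Lemma blip_F_incr : blip D (fun x => F_incr (t x) (p x) (v x)).
Proof.
have h1 := blip_f_incr ht hp hv; have h2 := blip_g_incr ht hp hv.
have h3 := blip_f hp; have h4 := blip_g (blip_cst D 0) hp.
by rewrite /F_incr; blips.
Qed.

Lemma blipv_step0 (c : R) : 0 < c -> blipv D (fun x => step0 c (p x)).
Proof.
move=> c0; have h1 := blip_gram hp; have h2 := blipv_g_dir hp.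
by rewrite /step0; blips.
Qed.

Lemma blipv_step1 (c : R) : 0 < c ->
  blipv D (fun x => step1 c (t x) (p x) (v x)).
Proof.
move=> c0; have h1 := blip_gram hp; have h2 := blipv_g_dir hp.
have h3 := blipv_f_dir hp; have h4 := blip_f_rem ht hp hv; have h5 := blip_g_rem hv.
by rewrite /step1; blips.
Qed.

End expressions2.

(** Weighted homogeneous of degree 60 for the weights (2, 3, 5), the degree of
F_t. *)
Definition wnorm (p : V) : R :=
  cmod (p 0 0) ^+ 30 + cmod (p 0 1) ^+ 20 + cmod (p 0 2) ^+ 12.

Lemma blip_wnorm (X : gauged R) (D : X -> Prop) (p : X -> V) : blipv D p ->
  blip D (fun x => rc (wnorm (p x))).
Proof. by move=> hp; rewrite /wnorm; blips. Qed.

Lemma blipv_id (D : gauged_row R 3 -> Prop) r : (forall p, D p -> norm1 p <= r) ->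
  blipv D (fun p : gauged_row R 3 => p : V).
Proof. by move=> h i; apply: blip_coord h _; exact: lipm_id. Qed.

Definition wscale (l : C) (p : V) : V :=
  vec (l ^+ 2 * p 0 0) (l ^+ 3 * p 0 1) (l ^+ 5 * p 0 2).

Lemma F_wscale t l p : F_fun t (wscale l p) = l ^+ 60 * F_fun t p.
Proof. by rewrite /F_fun /f_fun /g_fun /wscale !vecE; ring. Qed.

Lemma wnorm_wscale (l : C) p : wnorm (wscale l p) = cmod l ^+ 60 * wnorm p.
Proof.
have e n z : cmod (l ^+ n * z) = cmod l ^+ n * cmod z by rewrite cmodM cmodX.
by rewrite /wnorm /wscale !vecE !e; ring.
Qed.

Lemma wnorm_ge0 p : 0 <= wnorm p.
Proof. by rewrite !addr_ge0 ?exprn_ge0 ?cmod_ge0. Qed.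

Lemma wnorm0 : wnorm 0 = 0.
Proof. by rewrite /wnorm !mxE cmod0 !expr0n !addr0. Qed.

Lemma wnorm_le (b : R) p i : 1 <= b -> wnorm p <= b -> cmod (p 0 i) <= b.
Proof.
move=> b1 h; have le1 n (a : R) : 0 <= a -> a ^+ n.+1 <= b -> a <= b.
  move=> a0 an; rewrite leNgt; apply/negP => ba.
  have a1 : 1 <= a by rewrite (le_trans b1)// ltW.
  suff : a <= a ^+ n.+1 by move: an ba; lra.
  by rewrite exprS ler_peMr// exprn_ege1.
move: i; have h0 : 0 <= cmod (p 0 0) ^+ 30 by rewrite exprn_ge0 ?cmod_ge0.
have h1 : 0 <= cmod (p 0 1) ^+ 20 by rewrite exprn_ge0 ?cmod_ge0.
have h2 : 0 <= cmod (p 0 2) ^+ 12 by rewrite exprn_ge0 ?cmod_ge0.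
move: h; rewrite /wnorm => h.
apply: ord3_ind.
- apply: (@le1 29) (cmod_ge0 _) _; lra.
- apply: (@le1 19) (cmod_ge0 _) _; lra.
- apply: (@le1 11) (cmod_ge0 _) _; lra.
Qed.

Lemma norm1_3E (p : V) : norm1 p = cmod (p 0 0) + cmod (p 0 1) + cmod (p 0 2).
Proof.
rewrite /norm1 !big_ord_recl big_ord0 addr0 addrA;
by congr (_ + cmod (p 0 _) + cmod (p 0 _)); exact: val_inj.
Qed.

Lemma norm1_le_wnorm (b : R) p : 1 <= b -> wnorm p <= b -> norm1 p <= 3 * b.
Proof.
move=> b1 h; rewrite norm1_3E.
by have := wnorm_le 0 b1 h; have := wnorm_le 1 b1 h; have := wnorm_le 2 b1 h; lra.
Qed.

Lemma norm1_le3 p : wnorm p <= 1 -> norm1 p <= 3.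
Proof. by move=> h; have := norm1_le_wnorm (lexx 1) h; rewrite mulr1. Qed.

(** The function |F_0|^2 + gram + (wnorm - 1)^2 has no zero on the whole ball:
if its last term vanishes then p is not 0, and F_gram_eq0 applies. Its minimum on
the ball containing the weighted sphere is the bound. *)
Lemma F_gram_bound : exists2 c : R, 0 < c &
  forall p : V, wnorm p = 1 -> c <= cmod (F_fun 0 p) ^+ 2 + gram p.
Proof.
have [r'|v|c c0 hc] := @positive_lower_bound R 3
    (fun p => cmod (F_fun 0 p) ^+ 2 + gram p + cmod (rc (wnorm p) - 1) ^+ 2) 3.
- have hp := @blipv_id (fun v => norm1 v <= r') r' (fun p h => h).
  have h1 := blip_gram hp; have h2 := blip_F (blip_cst _ 0) hp; have h3 := blip_wnorm hp.
  by blips.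
- have := sqr_ge0 (cmod (F_fun 0 v)); have := gram_ge0 v.
  have := sqr_ge0 (cmod (rc (wnorm v) - 1)) => h1 h2 h3.
  rewrite lt_neqAle; apply/andP; split; last by lra.
  apply/eqP => h0.
  have F0 : F_fun 0 v = 0.
    by apply: cmod_eq0; apply/eqP; rewrite -sqrf_eq0; apply/eqP; lra.
  have v0 : v = 0 by apply: F_gram_eq0 => //; lra.
  have : cmod (rc (wnorm v) - 1) ^+ 2 = 0 by lra.
  rewrite v0 wnorm0 rc0 sub0r cmodN cmod1 expr1n => /eqP; by rewrite oner_eq0.
exists c => // p Np; have := hc p (norm1_le3 _).
by rewrite Np lexx rc1 subrr cmod0 expr0n addr0; exact.
Qed.

End regularity.

(** * Trivialization on the weighted sphere *)

(** The form a = b/60 + t (...) is the one that parametric_fixpoint solves; it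
expresses that (1 + t a)^60 = 1 + t b when T = taylor2 60 1 (t a). *)
Lemma root60_equation (K : numFieldType) (t a b T : K) :
  a = b / 60 + t * (- (a ^+ 2 * T) / 60) -> 60 * a + t * a ^+ 2 * T = b.
Proof. by move=> e; rewrite {1}e; field. Qed.

Section local_trivialization.
Variable R : realType.
Local Notation C := (Cplx R).
Local Notation V := 'rV[C]_3.
Local Notation X := (gauged_prod (gauged_C R) (gauged_row R 3)).

Lemma blip_time (D : X -> Prop) (r : R) : (forall x, D x -> cmod x.1 <= r) ->
  blip D (fun x : X => x.1).
Proof. by move=> h; apply: blip_lipm h _; exact: lipm_fst. Qed.

Lemma blipv_space (D : X -> Prop) (r : R) : (forall x, D x -> norm1 x.2 <= r) ->
  blipv D (fun x : X => x.2).
Proof. by move=> h i; apply: blip_coord h _; exact: lipm_snd. Qed.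

Lemma blip_fst (Y Z : gauged R) (D : Y -> Prop) (E : gauged_prod Y Z -> Prop)
    (f : Y -> C) : (forall q, E q -> D q.1) -> blip D f ->
  @blip _ (gauged_prod Y Z) E (fun q => f q.1).
Proof. by move=> s; apply: blip_comp s _; exact: lipm_fst. Qed.

Lemma blipv_fst (Y Z : gauged R) (D : Y -> Prop) (E : gauged_prod Y Z -> Prop) n
    (f : Y -> 'rV[C]_n) : (forall q, E q -> D q.1) -> blipv D f ->
  @blipv _ (gauged_prod Y Z) E n (fun q => f q.1).
Proof. by move=> s hf i; apply: (blip_fst s (hf i)). Qed.

Lemma blipv_unknown (Y : gauged R) n (D : gauged_prod Y (gauged_row R n) -> Prop)
    (r : R) :
  (forall q, D q -> norm1 q.2 <= r) -> @blipv _ _ D n (fun q => q.2).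
Proof. by move=> h i; apply: blip_coord h _; exact: lipm_snd. Qed.

Lemma exists_strict_bound (Y : gauged R) (D : Y -> Prop) n (f : Y -> 'rV[C]_n) :
  blipv D f -> exists r, forall y, D y -> norm1 (f y) <= r - 1.
Proof.
move=> /blip_row[M [_ h _]]; exists (M + 1) => y /h; lra.
Qed.

(** The difference quotient ((1 + t c)^n - 1) / t as a polynomial. *)
Definition pow_incr n (t c : C) : C := n%:R * c + t * c ^+ 2 * taylor2 n 1 (t * c).

Lemma pow_incrE n t c : (1 + t * c) ^+ n = 1 + t * pow_incr n t c.
Proof. by rewrite taylor2E /pow_incr !expr1n; ring. Qed.

Lemma blip_pow_incr (Y : gauged R) (D : Y -> Prop) n (t c : Y -> C) :
  blip D t -> blip D c -> blip D (fun y => pow_incr n (t y) (c y)).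
Proof.
move=> ht hc; have h1 := blip_cst D (1 : C); rewrite /pow_incr; blips.
Qed.

(** The displacement is written t phi with phi bounded Lipschitz, so that its
Lipschitz constant tends to 0 with t; this makes the resulting maps invertible. *)
Lemma local_trivialization : exists2 tau : R, 0 < tau &
  exists phi : C * V -> V,
    @blipv _ X (fun x => cmod x.1 <= tau /\ norm1 x.2 <= 3) 3 phi /\
    forall t p, cmod t <= tau -> wnorm p = 1 ->
      F_fun t (p + t *: phi (t, p)) = F_fun 0 p.
Proof.
(* c bounds |F_0|^2 + gram from below on the sphere: below the truncation level
   c / 2 of gram one has |F_0|^2 >= c / 2 *)
have [c c0 hc] := F_gram_bound R.
have c2 : 0 < c / 2 by rewrite divr_gt0.
have c8 : 0 < c / 8 by rewrite divr_gt0.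
pose D1 : X -> Prop := fun x => cmod x.1 <= 1 /\ norm1 x.2 <= 3.
have t1 : blip D1 (fun x => x.1) by apply: (@blip_time _ 1) => x [].
have p1 : blipv D1 (fun x => x.2) by apply: (@blipv_space _ 3) => x [].
have A1 := blipv_step0 p1 c2.
have [r1 Ar1] := exists_strict_bound A1.
have [|tau1 tau10 [v [hv bv]]] := @parametric_fixpoint R X D1 3 (fun x => x.1)
  (fun x => step0 (c / 2) x.2) (fun q => step1 (c / 2) q.1.1 q.1.2 q.2) r1 t1 A1 _ Ar1.
  apply: blipv_step1 => //.
  - by apply: (@blip_fst X (gauged_row R 3) D1) t1 => q [].
  - by apply: (@blipv_fst X (gauged_row R 3) D1) p1 => q [].
  - by apply: (@blipv_unknown _ _ _ r1) => q [].
(* G is F_t(p + t v), and F_0 = G (1 + t q) holds because q = - E / G unless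
   E = 0; the truncation level c / 8 is never reached where E is nonzero *)
pose D2 : X -> Prop := fun x => D1 x /\ cmod x.1 <= tau1.
have t2 : blip D2 (fun x => x.1) by apply: sub_blip t1 => x [].
have p2 : blipv D2 (fun x => x.2) by move=> i; apply: sub_blip (p1 i) => x [].
pose E (x : X) : C := F_incr x.1 x.2 (v x).
have bE : blip D2 E by exact: blip_F_incr.
pose G (x : X) : C := F_fun 0 x.2 + x.1 * E x.
have bG : blip D2 G.
  by have h := blip_F (blip_cst D2 0) p2; rewrite /G; blips.
pose q (x : X) : C := - (E x * cj (G x) * rc (Num.max (cmod (G x) ^+ 2) (c / 8))^-1).
have bq : blip D2 q by rewrite /q; blips.
have A2 : blipv D2 (fun x => \row_(i < 1) (q x / 60)).
  by apply: blipv_const; blips.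
have [r2 Ar2] := exists_strict_bound A2.
have [|tau2 tau20 [w [hw bw]]] := @parametric_fixpoint R X D2 1 (fun x => x.1)
  (fun x => \row_(i < 1) (q x / 60))
  (fun q => \row_(i < 1) (- (q.2 0 0 ^+ 2 * taylor2 60 1 (q.1.1 * q.2 0 0)) / 60))
  r2 t2 A2 _ Ar2.
  apply: blipv_const.
  have h1 : @blip _ (gauged_prod X (gauged_row R 1))
    (fun q => D2 q.1 /\ norm1 q.2 <= r2) (fun q => q.1.1).
    by apply: (@blip_fst X (gauged_row R 1) D2) t2 => y [].
  have h2 : @blipv _ (gauged_prod X (gauged_row R 1))
    (fun q => D2 q.1 /\ norm1 q.2 <= r2) _ (fun q => q.2).
    by apply: (@blipv_unknown _ _ _ r2) => y [].
  have h3 := blip_cst (fun q : gauged_prod X (gauged_row R 1) =>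
    D2 q.1 /\ norm1 q.2 <= r2) (1 : C).
  by blips.
(* s is the lower bound of |F_0| on the support of E, and tau3 keeps |t E| below
   s / 2 there *)
have [ME [ME0 hME _]] := bE.
pose s := Num.sqrt (c / 2).
have s0 : 0 < s by rewrite sqrtr_gt0.
have s2 : s ^+ 2 = c / 2 by rewrite sqr_sqrtr// ltW.
pose tau3 := s / 2 / (ME + 1).
have tau30 : 0 < tau3 by rewrite !divr_gt0//; lra.
pose tau := Num.min (Num.min 1 tau1) (Num.min tau2 tau3).
have tau0 : 0 < tau by rewrite /tau !lt_min tau10 tau20 tau30 ltr01.
exists tau => //.
pose cc (x : X) : C := w x 0 0.
(* p + t phi is the weighted action of 1 + t c on p + t v *)
pose phi (x : X) : V := v x + vec
  (pow_incr 2 x.1 (cc x) * (x.2 0 0 + x.1 * v x 0 0))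
  (pow_incr 3 x.1 (cc x) * (x.2 0 1 + x.1 * v x 0 1))
  (pow_incr 5 x.1 (cc x) * (x.2 0 2 + x.1 * v x 0 2)).
exists phi; split.
  pose D3 : X -> Prop := fun x => D2 x /\ cmod x.1 <= tau2.
  have D31 x : D3 x -> D1 x /\ cmod x.1 <= tau1 by case.
  have t3 : blip D3 (fun x => x.1) by apply: sub_blip t2 => x [].
  have p3 : blipv D3 (fun x => x.2) by move=> i; apply: sub_blip (p2 i) => x [].
  have v3 : blipv D3 v by move=> i; apply: sub_blip (bv i).
  have w3 : blip D3 cc by exact: bw.
  have h2 := blip_pow_incr 2 t3 w3; have h3 := blip_pow_incr 3 t3 w3.
  have h5 := blip_pow_incr 5 t3 w3.
  have : blipv D3 phi by rewrite /phi; blips.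
  move=> h i; apply: sub_blip (h i) => x [].
  by rewrite /tau !le_min => /andP[/andP[? ?] /andP[? ?]] ?.
move=> t p; rewrite /tau !le_min => /andP[/andP[ht1 htau1] /andP[htau2 htau3]] Np.
have D1x : D1 (t, p) by split => //; apply: norm1_le3; rewrite Np.
have D2x : D2 (t, p) by split.
have [_ hv1 _] := hv _ D1x htau1.
have [_ hw1 _] := hw _ D2x htau2.
set x := (t, p) in hv1 hw1 *.
have := congr1 (fun r : 'rV[C]_1 => r 0 0) hw1.
rewrite !mxE => cE.
have {}cE : cc x = q x / 60
    + t * (- (cc x ^+ 2 * taylor2 60 1 (t * cc x)) / 60) := cE.
have hq : (1 + t * cc x) ^+ 60 = 1 + t * q x.
  by rewrite pow_incrE; congr (1 + t * _); exact: root60_equation cE.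
have hG : G x * (1 + t * q x) = F_fun 0 p.
  have [dc|dc] := leP (c / 2) (gram p).
    have E0 : E x = 0 by exact: F_incr_eq0 c2 dc hv1.
    by rewrite /q /G E0 /=; ring.
  have F0 : s <= cmod (F_fun 0 p).
    rewrite -(@ler_pXn2r _ 2)// ?nnegrE ?cmod_ge0 ?(ltW s0)// s2.
    by have := hc _ Np; lra.
  have tE : cmod (t * E x) <= s / 2.
    rewrite cmodM (le_trans (ler_pM (cmod_ge0 _) (cmod_ge0 _) htau3 (hME _ D2x)))//.
    rewrite /tau3 mulrAC ler_pdivrMr ?ltr_wpDl//.
    by rewrite ler_wpM2l//; lra.
  have Gs : s / 2 <= cmod (G x).
    have := cmod_le_D (F_fun 0 p) (G x).
    have -> : F_fun 0 p - G x = - (t * E x) by rewrite /G /=; ring.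
    by rewrite cmodN; lra.
  have G2 : c / 8 <= cmod (G x) ^+ 2.
    have -> : c / 8 = (s / 2) ^+ 2 by rewrite exprMn s2; field.
    by rewrite ler_pXn2r// nnegrE ?cmod_ge0//; lra.
  have Gn0 : cmod (G x) ^+ 2 != 0 by rewrite gt_eqF//; lra.
  have Gr0 : G x * cj (G x) != 0.
    by rewrite mulcj; apply: contra Gn0 => /eqP/(@rc_inj R)->.
  rewrite /q max_l// rcV -mulcj.
  have -> : G x * (1 + t * - (E x * cj (G x) / (G x * cj (G x)))) =
    G x - t * E x * (G x * cj (G x) / (G x * cj (G x))) by ring.
  by rewrite divff// /G /=; ring.
have ephi : phi x = v x + vec
    (pow_incr 2 t (cc x) * (p 0 0 + t * v x 0 0))
    (pow_incr 3 t (cc x) * (p 0 1 + t * v x 0 1))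
    (pow_incr 5 t (cc x) * (p 0 2 + t * v x 0 2)) by [].
have -> : p + t *: phi x = wscale (1 + t * cc x) (p + t *: v x).
  by apply: eq_row3; rewrite /wscale ephi !vecE !(rowDE, rowZE) vecE
    pow_incrE; move: (pow_incr _ _ _) => a; ring.
by rewrite F_wscale hq F_shift -[RHS]hG mulrC.
Qed.

End local_trivialization.

(** * Weighted homogeneous extension *)

Section weighted_cone.
Variable R : realType.
Local Notation C := (Cplx R).
Local Notation V := 'rV[C]_3.
Local Notation X := (gauged_prod (gauged_C R) (gauged_row R 3)).
Implicit Types (p v : V) (t : C).

Definition root60 (a : R) : R := a `^ 60^-1.

Lemma root60_ge0 a : 0 <= root60 a. Proof. exact: powR_ge0. Qed.

Lemma root60_gt0 a : 0 < a -> 0 < root60 a. Proof. exact: powR_gt0. Qed.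

Lemma root60K a : 0 <= a -> root60 a ^+ 60 = a.
Proof.
move=> a0; rewrite -powR_mulrn ?root60_ge0// /root60 -powRrM mulVf ?pnatr_eq0//.
exact: powRr1.
Qed.

Lemma root60_unique a b : 0 <= b -> b ^+ 60 = a -> root60 a = b.
Proof.
move=> b0 e; apply: (@pexpIrn _ 60); rewrite ?nnegrE ?root60_ge0//.
by rewrite root60K -e ?exprn_ge0.
Qed.

Lemma root60_le a b : 0 <= a -> a <= b -> root60 a <= root60 b.
Proof.
move=> a0 ab; apply: ge0_ler_powR; rewrite ?invr_ge0 ?nnegrE//.
exact: le_trans ab.
Qed.

(** From a - b = (u - w)(u^59 + ... + w^59) for the 60-th roots u and w, where the
first term of the sum is at least root60(c)^59. *)
Lemma root60_lip (c a b : R) : 0 < c -> c <= a -> c <= b ->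
  `|root60 a - root60 b| <= (root60 c ^+ 59)^-1 * `|a - b|.
Proof.
move=> c0; have rc0 := root60_gt0 c0; wlog ab : a b / b <= a => [th|] ca cb.
  have [/th|/ltW /th] := leP b a; first exact.
  by rewrite distrC [`|a - b|]distrC; exact.
have a0 : 0 < a by exact: lt_le_trans ca.
have b0 : 0 < b by exact: lt_le_trans cb.
have rab : root60 b <= root60 a by exact: root60_le (ltW _) _.
have rca : root60 c <= root60 a by exact: root60_le (ltW _) _.
rewrite !ger0_norm ?subr_ge0// ler_pdivlMl ?exprn_gt0//.
rewrite -[in leRHS](root60K (ltW a0)) -[in leRHS](root60K (ltW b0)) subrXX mulrC.
rewrite ler_wpM2l ?subr_ge0// big_ord_recl /= subn0 expr0 mulr1 ler_wpDr//.
  by apply: sumr_ge0 => i _; rewrite mulr_ge0 ?exprn_ge0 ?root60_ge0.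
by rewrite ler_pXn2r ?nnegrE ?root60_ge0.
Qed.

Lemma wnorm_gt0 p : p != 0 -> 0 < wnorm p.
Proof.
move=> p0; rewrite lt_neqAle wnorm_ge0 andbT eq_sym; apply: contra p0 => /eqP h.
have h0 : 0 <= cmod (p 0 0) ^+ 30 by rewrite exprn_ge0 ?cmod_ge0.
have h1 : 0 <= cmod (p 0 1) ^+ 20 by rewrite exprn_ge0 ?cmod_ge0.
have h2 : 0 <= cmod (p 0 2) ^+ 12 by rewrite exprn_ge0 ?cmod_ge0.
have z n i : cmod (p 0 i) ^+ n.+1 = 0 -> p 0 i = 0.
  by move=> /eqP; rewrite expf_eq0 /= => /eqP; exact: cmod_eq0.
move: h; rewrite /wnorm => h; apply/eqP; apply: eq_row3; rewrite mxE.
- by apply: (z 29); lra.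
- by apply: (z 19); lra.
- by apply: (z 11); lra.
Qed.

Definition rho p : R := root60 (wnorm p).

Lemma rho_gt0 p : p != 0 -> 0 < rho p.
Proof. by move=> /wnorm_gt0; exact: root60_gt0. Qed.

Lemma rho0 : rho (0 : V) = 0.
Proof. by rewrite /rho wnorm0; apply: root60_unique; rewrite // expr0n. Qed.

Lemma wscaleA a b p : wscale a (wscale b p) = wscale (a * b) p.
Proof. by rewrite /wscale !vecE !exprMn !mulrA. Qed.

Lemma wscale1 p : wscale 1 p = p.
Proof. by apply: eq_row3; rewrite /wscale vecE expr1n mul1r. Qed.

Lemma wscale0l p : wscale 0 p = 0.
Proof. by apply: eq_row3; rewrite /wscale vecE expr0n mul0r mxE. Qed.

Lemma wscale0r (a : C) : wscale a 0 = 0.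
Proof. by apply: eq_row3; rewrite /wscale vecE !mxE mulr0. Qed.

Lemma wscaleD a t p v : wscale a (p + t *: v) = wscale a p + t *: wscale a v.
Proof.
by apply: eq_row3; rewrite /wscale !(rowDE, rowZE) !vecE mulrDr mulrCA.
Qed.

Lemma rcK (l : R) : l != 0 -> rc l * rc l^-1 = 1.
Proof. by move=> l0; rewrite -rcM divff. Qed.

Lemma wscaleK (l : R) p : l != 0 -> wscale (rc l) (wscale (rc l^-1) p) = p.
Proof. by move=> l0; rewrite wscaleA rcK// wscale1. Qed.

Lemma wnorm_real_scale (l : R) p : 0 <= l -> wnorm (wscale (rc l) p) = l ^+ 60 * wnorm p.
Proof. by move=> l0; rewrite wnorm_wscale cmod_rc ger0_norm. Qed.

Lemma rho_scale (l : R) p : 0 <= l -> rho (wscale (rc l) p) = l * rho p.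
Proof.
move=> l0; apply: root60_unique; first by rewrite mulr_ge0 ?root60_ge0.
by rewrite wnorm_real_scale// exprMn root60K ?wnorm_ge0.
Qed.

Definition wunit p : V := wscale (rc (rho p)^-1) p.

Lemma wunitK p : p != 0 -> wscale (rc (rho p)) (wunit p) = p.
Proof. by move=> p0; rewrite wscaleK// gt_eqF// rho_gt0. Qed.

Lemma wnorm_wunit p : p != 0 -> wnorm (wunit p) = 1.
Proof.
move=> p0; have r0 := rho_gt0 p0.
rewrite /wunit wnorm_real_scale ?invr_ge0 ?(@ltW _ _ 0)//.
have e : wnorm p = rho p ^+ 60 by rewrite root60K ?wnorm_ge0.
by rewrite e -exprMn mulVf ?expr1n// gt_eqF.
Qed.

Lemma wunit_scale (l : R) p : 0 < l -> p != 0 -> wunit (wscale (rc l) p) = wunit p.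
Proof.
move=> l0 p0; rewrite /wunit rho_scale ?(@ltW _ _ 0)// wscaleA -rcM.
congr (wscale (rc _) p).
by rewrite invfM mulrAC mulVf ?mul1r// gt_eqF.
Qed.

(** At p = 0 both rho and its inverse are 0, so the extension takes the value 0
there. *)
Definition cone_ext (k : V -> V) p : V := wscale (rc (rho p)) (k (wunit p)).

Lemma cone_ext0 k : cone_ext k 0 = 0.
Proof. by rewrite /cone_ext rho0 rc0 wscale0l. Qed.

Lemma cone_ext1 k p : wnorm p = 1 -> cone_ext k p = k p.
Proof.
move=> p1; have r1 : rho p = 1 by apply: root60_unique; rewrite // expr1n.
by rewrite /cone_ext /wunit r1 invr1 rc1 !wscale1.
Qed.

Lemma cone_ext_scale k (l : R) p : 0 < l ->
  cone_ext k (wscale (rc l) p) = wscale (rc l) (cone_ext k p).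
Proof.
move=> l0; have [->|p0] := eqVneq p 0; first by rewrite wscale0r cone_ext0 wscale0r.
by rewrite /cone_ext wunit_scale// rho_scale ?(@ltW _ _ 0)// rcM wscaleA.
Qed.

(** The weighted norm truncated from below: it is Lipschitz across the origin and
agrees with rho where wnorm p >= e. *)
Definition trunc_rho (e : R) p : R := root60 (Num.max (wnorm p) e).
Definition trunc_unit (e : R) p : V := wscale (rc (trunc_rho e p)^-1) p.
Definition trunc_ext (e : R) (k : V -> V) p : V :=
  wscale (rc (trunc_rho e p)) (k (trunc_unit e p)).

Lemma trunc_extE (e : R) k p : e <= wnorm p -> trunc_ext e k p = cone_ext k p.
Proof. by move=> h; rewrite /trunc_ext /trunc_unit /trunc_rho max_l. Qed.

Lemma trunc_rho_gt0 (e : R) p : 0 < e -> 0 < trunc_rho e p.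
Proof. by move=> e0; apply: root60_gt0; rewrite lt_max e0 orbT. Qed.

Lemma norm1_trunc_unit (e : R) p : 0 < e -> norm1 (trunc_unit e p) <= 3.
Proof.
move=> e0; apply: norm1_le3; have r0 := trunc_rho_gt0 p e0.
rewrite /trunc_unit wnorm_real_scale ?invr_ge0 ?(@ltW _ _ 0)// exprVn.
rewrite /trunc_rho root60K; last first.
  by rewrite le_max wnorm_ge0.
have m0 : 0 < Num.max (wnorm p) e by rewrite lt_max e0 orbT.
by rewrite ler_pdivrMl// mulr1 le_max lexx.
Qed.

Lemma blip_trunc_rho (Y : gauged R) (D : Y -> Prop) (e : R) (p : Y -> V) :
  0 < e -> blipv D p -> blip D (fun y => rc (trunc_rho e (p y))).
Proof.
move=> e0 /blip_wnorm bN; apply: (blip_real_comp (G := fun a => root60 (Num.max a e))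
  (K := (root60 e ^+ 59)^-1)) bN => a b.
have le_max0 u : e <= Num.max u e by rewrite le_max lexx orbT.
apply: le_trans (root60_lip e0 (le_max0 a) (le_max0 b)) _.
rewrite ler_wpM2l ?invr_ge0 ?exprn_ge0 ?root60_ge0//.
case: (leP a e) => ac; case: (leP b e) => bc.
- by rewrite subrr normr0.
- by rewrite !ltr0_norm; lra.
- by rewrite !gtr0_norm; lra.
- by [].
Qed.

Lemma blip_trunc_rhoV (Y : gauged R) (D : Y -> Prop) (e : R) (p : Y -> V) :
  0 < e -> blipv D p -> blip D (fun y => rc (trunc_rho e (p y))^-1).
Proof.
move=> e0 hp; have h := blip_trunc_rho e0 hp; have r0 := root60_gt0 e0.
apply: eq_blip (blip_invmax r0 h) => y _; rewrite max_l//.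
by apply: root60_le; [exact: ltW | rewrite le_max lexx orbT].
Qed.

Lemma blipv_wscale (Y : gauged R) (D : Y -> Prop) (l : Y -> C) (p : Y -> V) :
  blip D l -> blipv D p -> blipv D (fun y => wscale (l y) (p y)).
Proof. by move=> hl hp; rewrite /wscale; blips. Qed.

Definition domain (tau r : R) (x : X) : Prop := cmod x.1 <= tau /\ norm1 x.2 <= r.

Lemma blipv_trunc_ext (e tau r : R) (k : C * V -> V) : 0 < e ->
  blipv (domain tau 3) k ->
  blipv (domain tau r) (fun x => trunc_ext e (fun p => k (x.1, p)) x.2).
Proof.
move=> e0 hk.
have ht : blip (domain tau r) (fun x => x.1) by apply: (@blip_time _ _ tau) => x [].
have hp : blipv (domain tau r) (fun x => x.2) by apply: (@blipv_space _ _ r) => x [].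
apply: blipv_wscale; first exact: blip_trunc_rho.
have hh : blipv (domain tau r) (fun x => trunc_unit e x.2).
  by apply: blipv_wscale => //; exact: blip_trunc_rhoV.
move=> i; apply: (@blip_comp _ X X _ (domain tau 3) (fun x => (x.1, trunc_unit e x.2))
  (fun x => k x 0 i)) (hk i).
  by move=> x [tx _]; split => //; exact: norm1_trunc_unit.
by apply: lipm_pair; [exact: lipm_fst | exact: lipm_row hh].
Qed.

Lemma norm1_wscale_le (l : R) v : 0 <= l -> l <= 1 ->
  norm1 (wscale (rc l) v) <= l * norm1 v.
Proof.
move=> l0 l1; rewrite !norm1_3E /wscale !vecE !mulrDr.
have h n z : cmod (rc l ^+ n.+1 * z) <= l * cmod z.
  rewrite cmodM cmodX cmod_rc ger0_norm// ler_wpM2r ?cmod_ge0// exprS.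
  by rewrite ler_piMr// exprn_ile1.
by rewrite !lerD.
Qed.

(** Away from the origin the extension coincides locally with a truncated one,
which is Lipschitz. At the origin its norm is at most rho(p) times a bound of
k. *)
Lemma cone_ext_continuous_at (tau : R) (k : C * V -> V) t p :
  blipv (domain tau 3) k -> cmod t <= tau ->
  forall eps : R, 0 < eps -> exists2 d : R, 0 < d & forall s q, cmod s <= tau ->
    cmod (t - s) + norm1 (p - q) < d ->
    norm1 (cone_ext (fun y => k (t, y)) p - cone_ext (fun y => k (s, y)) q) < eps.
Proof.
move=> hk ht eps eps0; have [p0|p0] := eqVneq p 0.
  have /blip_row[M [M0 kM _]] := hk.
  have [N [N0 _ hN]] := blip_wnorm (@blipv_id R (fun v => norm1 v <= 1) 1 (fun _ h => h)).
  pose e := Num.min 1 (eps / (M + 1)).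
  have e0 : 0 < e by rewrite lt_min ltr01 divr_gt0//; lra.
  exists (Num.min 1 (e ^+ 60 / (N + 1))).
    by rewrite lt_min ltr01 divr_gt0 ?exprn_gt0//; lra.
  move=> s q hs; rewrite p0 cone_ext0 !sub0r !norm1N lt_min => /andP[d1 d2].
  have q1 : norm1 q < 1 by have := cmod_ge0 (t - s); lra.
  have {}d2 : norm1 q * (N + 1) < e ^+ 60.
    rewrite -ltr_pdivlMr; last by lra.
    by have := cmod_ge0 (t - s); lra.
  have wq : wnorm q < e ^+ 60.
    have n1 : norm1 (0 : V) <= 1 by rewrite norm10.
    have := hN q 0 (ltW q1) n1; rewrite -rcB cmod_rc wnorm0 subr0 ger0_norm ?wnorm_ge0//.
    by rewrite /= subr0 => h; have := norm1_ge0 q; lra.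
  have rq : rho q < e.
    rewrite -(@ltr_pXn2r _ 60)// ?nnegrE ?root60_ge0// ?(ltW e0)//.
    by rewrite root60K ?wnorm_ge0.
  have kq : norm1 (k (s, wunit q)) <= M.
    apply: kM; split => //=; have [->|q0] := eqVneq q 0.
      by rewrite /wunit wscale0r norm10.
    by apply: norm1_le3; rewrite wnorm_wunit.
  have [e1 e2] : e <= 1 /\ e <= eps / (M + 1).
    by split; rewrite /e ge_min lexx ?orbT.
  have r0 : 0 <= rho q := root60_ge0 _.
  apply: le_lt_trans (norm1_wscale_le _ r0 (ltW (lt_le_trans rq e1))) _.
  apply: le_lt_trans (ler_wpM2l r0 kq) _.
  have : rho q * (M + 1) < eps.
    by rewrite -ltr_pdivlMr; [exact: lt_le_trans rq e2 | lra].
  by lra.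
have w0 := wnorm_gt0 p0; pose e := wnorm p / 2.
have e0 : 0 < e by rewrite divr_gt0.
pose r := norm1 p + 1.
have /blip_row[M [M0 _ hM]] := @blipv_trunc_ext e tau r k e0 hk.
have [N [N0 _ hN]] := blip_wnorm (@blipv_id R (fun v => norm1 v <= r) r (fun _ h => h)).
exists (Num.min 1 (Num.min (e / (N + 1)) (eps / (M + 1)))).
  by rewrite !lt_min ltr01 !divr_gt0//; lra.
move=> s q hs; rewrite !lt_min => /andP[d1 /andP[d2 d3]].
have s0 := cmod_ge0 (t - s); have n0 := norm1_ge0 (p - q).
have {}d2 : (cmod (t - s) + norm1 (p - q)) * (N + 1) < e by rewrite -ltr_pdivlMr//; lra.
have {}d3 : (cmod (t - s) + norm1 (p - q)) * (M + 1) < eps by rewrite -ltr_pdivlMr//; lra.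
have pr : norm1 p <= r by rewrite /r lerDl.
have qr : norm1 q <= r.
  have -> : q = p + (q - p) by rewrite addrC subrK.
  by rewrite (le_trans (norm1D _ _))// /r lerD2l norm1B; lra.
have wq : e <= wnorm q.
  have := hN p q pr qr; rewrite -rcB cmod_rc /= => h.
  have h2 := le_trans (ler_norm _) h.
  have h3 : N * norm1 (p - q) <= (cmod (t - s) + norm1 (p - q)) * (N + 1).
    by rewrite mulrC ler_pM//; lra.
  by move: h2; rewrite /e in d2 *; lra.
rewrite -!(@trunc_extE e) //; last by rewrite /e; lra.
have := hM (t, p) (s, q) (conj ht pr) (conj hs qr) => /= h.
apply: le_lt_trans h _; apply: le_lt_trans d3.
by rewrite mulrC ler_wpM2l//; lra.
Qed.

End weighted_cone.

(** * Bijectivity of the extension and the trivialization theorem *)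

Section globalization.
Variable R : realType.
Local Notation C := (Cplx R).
Local Notation V := 'rV[C]_3.
Local Notation X := (gauged_prod (gauged_C R) (gauged_row R 3)).
Implicit Types (p q y : V) (t : C).

Lemma F_cone_ext t (k : V -> V) : (forall p, wnorm p = 1 -> F_fun t (k p) = F_fun 0 p) ->
  forall p, F_fun t (cone_ext k p) = F_fun 0 p.
Proof.
move=> hk p; have [->|p0] := eqVneq p 0.
  have F0 s : F_fun s (wscale 0 (0 : V)) = 0 by rewrite F_wscale expr0n mul0r.
  by rewrite cone_ext0 -(wscale0l (0 : V)) !F0.
by rewrite /cone_ext F_wscale hk ?wnorm_wunit// -F_wscale wunitK.
Qed.

(** The weighted action is linear on C^3, so the extension of id + t f is again
a perturbation of the identity by t times an extension. *)
Lemma cone_ext_perturbation (e : R) t (f : V -> V) p : 0 < e -> e <= wnorm p ->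
  cone_ext (fun q => q + t *: f q) p = p + t *: trunc_ext e f p.
Proof.
move=> e0 ep; have p0 : p != 0.
  apply/eqP => p0; move: ep; rewrite p0 wnorm0; lra.
by rewrite trunc_extE// /cone_ext wscaleD wunitK.
Qed.

(** By homogeneity both identities need to be checked on one point of each
orbit of the positive reals only. If wnorm y = 1, a solution x of
x = y - t W(t, x) stays in the region wnorm >= 1/2 where the truncated W is the
true one, so h x = y. Conversely, if wnorm x = 1 and y = h x, then x / rho(y)
solves the equation attached to y / rho(y), and uniqueness of the solution in
the ball of radius 6 identifies it. *)
Lemma cone_ext_bijective (tau : R) (phi : C * V -> V) : 0 < tau ->
  blipv (domain tau 3) phi ->
  exists2 tau', 0 < tau' <= tau & exists k' : C * V -> V,
    blipv (domain tau' 3) k' /\ forall t, cmod t <= tau' ->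
      let h := cone_ext (fun p => p + t *: phi (t, p)) in
      let g := cone_ext (fun p => k' (t, p)) in cancel h g /\ cancel g h.
Proof.
move=> tau0 bphi; (* wnorm will vary by at most 1/2 from the value 1, so W is truncated at 1/2 *)
have e0 : 0 < 2^-1 :> R by rewrite invr_gt0.
pose W (x : X) := trunc_ext 2^-1 (fun p => phi (x.1, p)) x.2.
have bW : blipv (domain tau 6) W by exact: blipv_trunc_ext.
have bt : blip (domain tau 3) (fun x => x.1) by apply: (@blip_time _ _ tau) => x [].
have bp : blipv (domain tau 3) (fun x => x.2) by apply: (@blipv_space _ _ 3) => x [].
have [||tau1 tau10 [G [hG bG]]] := @parametric_fixpoint R X (domain tau 3) 3
  (fun x => x.1) (fun x => x.2) (fun z => - W (z.1.1, z.2)) 6 bt bp.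
- apply: blipvN => i; apply: (@blip_comp _ (gauged_prod X (gauged_row R 3)) X _ (domain tau 6)
    (fun z => (z.1.1, z.2)) (fun x => W x 0 i)) (bW i).
    by move=> z [[]].
  apply: lipm_pair; last exact: lipm_snd.
  apply: (@lipm_comp _ (gauged_prod X (gauged_row R 3)) X (gauged_C R) _
    (fun=> True) fst fst) => //.
    exact: lipm_fst.
  exact: lipm_fst.
- by move=> x [_]; lra.
have /blip_row[M [M0 hM _]] := bW.
have /blip_row[M' [M'0 hM' _]] := bphi.
have [N [N0 _ hN]] := blip_wnorm (@blipv_id R (fun v => norm1 v <= 6) 6 (fun _ h => h)).
(* N is a Lipschitz constant of wnorm; for |t| <= tau2 a displacement t v with
   v bounded by M + M' changes wnorm by at most 1/2 *)
pose K := (N + 1) * (M + M' + 1).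
have K0 : 0 < K by rewrite mulr_gt0//; lra.
pose tau2 := (2 * K)^-1.
have tau20 : 0 < tau2 by rewrite invr_gt0 mulr_gt0.
have small t p q v : cmod t <= tau2 -> norm1 v <= M + M' -> q = p + t *: v ->
    norm1 p <= 3 -> norm1 (q - p) <= 1 / 2 /\ `|wnorm q - wnorm p| <= 1 / 2.
  move=> ht hv e hp.
  have e1 : q - p = t *: v by rewrite e addrC addKr.
  have n1 : norm1 (q - p) <= tau2 * (M + M').
    by rewrite e1 norm1Z ler_pM ?cmod_ge0 ?norm1_ge0.
  have k1 : tau2 * K = 1 / 2 by rewrite /tau2; field; rewrite gt_eqF.
  have k2 : tau2 * (M + M') <= 1 / 2.
    rewrite -k1 ler_wpM2l ?(@ltW _ _ 0)// /K -[leLHS]mul1r ler_pM//; lra.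
  have k3 : N * (tau2 * (M + M')) <= 1 / 2.
    rewrite -k1 mulrCA ler_wpM2l ?(@ltW _ _ 0)// /K ler_pM//; lra.
  have h1 := le_trans n1 k2; split => //.
  have hq : norm1 q <= 6.
    by rewrite -(subrK p q) (le_trans (norm1D _ _))//; lra.
  have hp6 : norm1 p <= 6 by lra.
  have := hN q p hq hp6; rewrite -rcB cmod_rc => h; apply: le_trans h _.
  by apply: le_trans k3; rewrite ler_wpM2l.
exists (Num.min tau (Num.min tau1 tau2)).
  by rewrite ge_min lexx !lt_min tau0 tau10 tau20.
exists G; split.
  move=> i; apply: sub_blip (bG i) => x [].
  by rewrite !le_min => /andP[? /andP[? _]] ?.
move=> t; rewrite !le_min => /andP[ht /andP[ht1 ht2]] h g.
have HW x : 2^-1 <= wnorm x -> h x = x + t *: W (t, x).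
  by move=> hx; rewrite /h (cone_ext_perturbation _ _ e0 hx).
have HG y : wnorm y = 1 -> h (G (t, y)) = y.
  move=> y1; have ny : norm1 y <= 3 by apply: norm1_le3; rewrite y1.
  have [nG eG _] := hG (t, y) (conj ht ny) ht1.
  have {}eG : G (t, y) = y + t *: - W (t, G (t, y)) := eG.
  have nW : norm1 (- W (t, G (t, y))) <= M + M'.
    by rewrite norm1N; have := hM (t, G (t, y)) (conj ht nG); lra.
  have [_] := small _ _ _ _ ht2 nW eG ny; rewrite y1 ler_norml => /andP[hw _].
  rewrite HW; last by lra.
  by rewrite {1}eG scalerN subrK.
split.
  move=> p; have [->|p0] := eqVneq p 0; first by rewrite /h /g !cone_ext0.
  have r0 := rho_gt0 p0.
  have hs l q : 0 < l -> h (wscale (rc l) q) = wscale (rc l) (h q).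
    exact: cone_ext_scale.
  have gs l q : 0 < l -> g (wscale (rc l) q) = wscale (rc l) (g q).
    exact: cone_ext_scale.
  suff gh : g (h (wunit p)) = wunit p by rewrite -[in LHS](wunitK p0) hs// gs// gh wunitK.
  set x := wunit p.
  have x1 : wnorm x = 1 by exact: wnorm_wunit.
  have nx : norm1 x <= 3 by apply: norm1_le3; rewrite x1.
  set y := h x.
  have ey : y = x + t *: phi (t, x) by rewrite /y /h cone_ext1.
  have np : norm1 (phi (t, x)) <= M + M' by have := hM' (t, x) (conj ht nx); lra.
  have [_] := small _ _ _ _ ht2 np ey nx; rewrite x1 ler_norml => /andP[w1 w2].
  have y0 : y != 0 by apply/eqP => y0; move: w1; rewrite y0 wnorm0; lra.
  have ry := rho_gt0 y0.
  pose u := wscale (rc (rho y)^-1) x.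
  have wu : wnorm u = (wnorm y)^-1.
    rewrite /u wnorm_real_scale ?invr_ge0 ?(@ltW _ _ 0)// x1 mulr1.
    by rewrite exprVn /rho root60K ?wnorm_ge0.
  have wy0 := wnorm_gt0 y0.
  have u2 : wnorm u <= 2 by rewrite wu invf_ple ?posrE//; lra.
  have ub : 2^-1 <= wnorm u by rewrite wu lef_pV2 ?posrE//; lra.
  have nu : norm1 u <= 6 by have := norm1_le_wnorm _ u2; lra.
  have hu : h u = wunit y by rewrite /u hs ?invr_gt0.
  have nhy : norm1 (wunit y) <= 3 by apply: norm1_le3; rewrite wnorm_wunit.
  have [_ _ uniq] := hG (t, wunit y) (conj ht nhy) ht1.
  rewrite /g /cone_ext; have <- : u = G (t, wunit y).
    apply: uniq => //=; rewrite -hu HW// scalerN addrK.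
    by [].
  by rewrite /u wscaleK// gt_eqF.
move=> y; have [->|y0] := eqVneq y 0; first by rewrite /h /g !cone_ext0.
rewrite /g /cone_ext -/(wunit y) /h cone_ext_scale ?rho_gt0// -/h HG ?wnorm_wunit//.
exact: wunitK.
Qed.

End globalization.

Theorem mainTheorem7 (R : realType) :
  topologically_right_equivalent_trivial (@F_fun R).
Proof.
have [tau0 tau00 [phi [bphi hphi]]] := local_trivialization R.
have [tau /andP[tau_gt0 tau_le] [k' [bk' hk']]] := cone_ext_bijective tau00 bphi.
pose k (x : Cplx R * 'rV[Cplx R]_3) := x.2 + x.1 *: phi x.
have bk : blipv (domain tau 3) k.
  have ht : blip (domain tau 3) (fun x => x.1) by apply: (@blip_time _ _ tau) => x [].
  have hp : blipv (domain tau 3) (fun x => x.2) by apply: (@blipv_space _ _ 3) => x [].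
  have hf : blipv (domain tau 3) phi.
    by move=> i; apply: sub_blip (bphi i) => x [h ?]; split => //; exact: le_trans h _.
  exact: blipvD hp (blipvZ ht hf).
pose h t := cone_ext (fun p => k (t, p)).
pose g t := cone_ext (fun p => k' (t, p)).
have slice (k0 : Cplx R * 'rV[Cplx R]_3 -> 'rV[Cplx R]_3) t :
    blipv (domain tau 3) k0 -> cmod t <= tau ->
    {within setT, continuous (cone_ext (fun p => k0 (t, p)))}.
  move=> bk0 ht; refine (@within_continuous_gauge R 'rV[Cplx R]_3
    (fun p q => norm1 (p - q)) 3 setT _ _ _).
    exact: nbhs_rV.
  move=> p _ e e0; have [d d0 hd] := cone_ext_continuous_at p bk0 ht e0.
  by exists d => // q _ pq; apply: hd => //; rewrite subrr cmod0 add0r.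
exists [set t : Cplx R | cmod t <= tau], setT, h; split.
- apply: filterS (nbhs_C 0 tau_gt0) => t /=; rewrite sub0r cmodN; exact: ltW.
- exact: filterT.
- apply: (within_continuous_gauge
    (d := @gdist R (gauged_prod (gauged_C R) (gauged_row R 3)))).
    by move=> x e e0; exact: nbhs_C_rV.
  move=> [t p] [/= ht _] e e0; have [d d0 hd] := cone_ext_continuous_at p bk ht e0.
  by exists d => // -[s q] [/= hs _] pq; exact: hd.
move=> t ht; have [hg gh] := hk' t ht; split.
- exists setT; first exact: filterT.
  split; last split; last by exists (g t); split => [p _|]; [exact: hg | exact: slice].
    split; first by move=> p _.
      by apply: in2W; apply: can_inj hg.
    by move=> p _; exists (g t p) => //; exact: gh.
  exact: slice.
- exact: cone_ext0.
move=> p _; apply: F_cone_ext => q q1; apply: hphi => //; exact: le_trans ht tau_le.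
Qed.
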